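(* Let $k\geq 2$ be an integer, let $C$ be a nonzero integer, and let $f(x,y)=xy^k+C\in\mathbb{Z}[x,y]$. For $H\ge 1$ let $S(H)$ be the number of pairs of integers $(x,y)$ with $1\leq x,y\leq H$ such that $f(x,y)$ is $k$-free. Then there exists a real number $\delta=\delta(k,f)>0$ such that $$S(H)=c_f H^2+O\left(H^{2-\delta}\right),$$ where $$c_f=\prod_p\left(1-\frac{\rho(p^k)}{p^{2k}}\right),$$ the product being over all primes $p$, and where for each positive integer $m$ $$\rho(m)=\#\left\{(\mu,\nu)\in(\mathbb{Z}/m\mathbb{Z})^2 : f(\mu,\nu)\equiv 0\pmod m\right\}.$$
   Context: For an integer $k\ge 2$, an integer $n$ is called $k$-free if there is no prime $p$ such that $p^k\mid n$ (in particular $0$ is not $k$-free). The implied constant in the $O$-symbol is independent of $H$; it may depend on $k$ and $C$. *)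

(* Defs.v *)
From HB Require Import structures.
From mathcomp Require Import all_boot all_order all_algebra.
From mathcomp Require Import finmap.
From mathcomp Require Import all_classical all_reals all_analysis.

Set Implicit Arguments.
Unset Strict Implicit.
Unset Printing Implicit Defensive.

Import Order.TTheory GRing.Theory Num.Theory.
Import numFieldNormedType.Exports.

Local Open Scope classical_set_scope.
Local Open Scope ring_scope.

Definition kfree (k : nat) (n : int) : Prop :=
  ~ exists2 p : nat, prime p & ((p ^ k)%N%:Z %| n)%Z.

Definition fpoly (k : nat) (C : int) (x y : int) : int := x * y ^+ k + C.

Definition kfree_pairs (R : realType) (k : nat) (f : int -> int -> int)
    (H : R) : set (int * int) :=
  [set xy | [/\ 1 <= (xy.1%:~R : R) <= H, 1 <= (xy.2%:~R : R) <= H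
    & kfree k (f xy.1 xy.2)]].

(* [fset_set] is the empty set on infinite sets: this lemma shows that the
   count [kfree_count] below is not affected by that convention. *)
Lemma finite_kfree_pairs (R : realType) (k : nat) (f : int -> int -> int)
    (H : R) : finite_set (kfree_pairs k f H).
Proof.
pose N := (Num.truncn H).+1.
apply: (@sub_finite_set _ _
  ((fun ij : 'I_N * 'I_N => ((ij.1 : nat)%:Z, (ij.2 : nat)%:Z)) @` setT)); last first.
  exact/finite_image/finite_finset.
have ltN (z : int) : 1 <= (z%:~R : R) <= H -> exists i : 'I_N, z = (i : nat)%:Z.
  case: z => [n|n] /andP[z1 zH].
    have nN : (n < N)%N.
      by rewrite ltnS truncn_ge_nat// (le_trans _ zH)// (le_trans _ z1).
    by exists (Ordinal nN).
  by move: z1; rewrite -[1 : R]/(1%:~R) ler_int.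
move=> [x y] [/= /ltN[i ->] /ltN[j ->] _].
by exists (i, j).
Qed.

Definition kfree_count (R : realType) (k : nat) (f : int -> int -> int)
    (H : R) : nat := #|` fset_set (kfree_pairs k f H)|.

(* Residue classes mod m are represented by 0, ..., m - 1; unlike ['Z_m], the
   type ['I_m] has m elements for every m, including m = 1. *)
Definition rho (f : int -> int -> int) (m : nat) : nat :=
  #|[set uv : 'I_m * 'I_m | (m%:Z %| f (uv.1 : nat)%:Z (uv.2 : nat)%:Z)%Z]%SET|.

Definition euler_partial (R : realType) (k : nat) (f : int -> int -> int)
    (N : nat) : R :=
  \prod_(p < N | prime p) (1 - (rho f (p ^ k))%:R / (p ^ (2 * k))%:R).

Definition euler_product (R : realType) (k : nat) (f : int -> int -> int) : R :=
  limn (euler_partial R k f).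

(* Main.v *)
(** Primes p <= t, where t is a small power of H, are sieved out with Moebius
    sums truncated at t^2; this gives the main term.  For t < p <= H^(1-eps), a
    fixed y leaves O(H/p^k + 1) values of x.  For p > H^(1+eps), write
    x y^k + C = m p^k: here m is small, and x and m determine y because
    m (p'^k y^k - p^k y'^k) = C (y^k - y'^k).  In the critical range p ~ H, fix p
    and a short window y = y0 + u.  Determinants in the monomials u^i and x u^j
    at the solutions (x, u) are divisible by a power of p^k larger than their
    size, so all solutions lie on one curve P(u) + x Q(u) = 0.  Either Q is
    constant and the solutions are roots of a polynomial modulo p, or Q(u)
    divides the resultant of P and Q and the divisor bound applies. *)

Require Import Defs.
From HB Require Import structures.
From mathcomp Require Import all_boot all_order all_fingroup all_algebra.
From mathcomp Require Import finmap zify ring lra.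
From mathcomp Require Import boolp.

Set Implicit Arguments.
Unset Strict Implicit.
Unset Printing Implicit Defensive.

Import Order.TTheory GRing.Theory Num.Theory.

(** * Divisor bound *)

(** The obstacle is p near H: O(1) values of x for each pair (p, y) already add up to about H^2, the
    order of the main term. Any power saving there suffices, so all other estimates may be crude.
    With a pure powers of u and k + a monomials x u^j, the determinant is divisible by p^(a k),
    while its size is about p^(k+a) up to powers of the window length. This requires a k > k + a,
    that is (a - 1)(k - 1) > 1, and a = 3 is the least choice that serves k = 2; hence the three
    monomials 1, u, u^2. The divisor bound costs only a small power of H if the resultant is
    polynomially bounded in H. This is why relations of bounded height are needed and not merely
    relations. All sizes are powers of one integer t with N ~ t^w, where N is the integer part of H:
    the critical range is t^(w-1) < p <= t^(w+1), windows have length t^4, each error is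
    O(t^(2w-1)), and delta = 1/w. Real exponents appear only at the very end. *)

(** A divisor d of p^e m is recovered from the exponent a with gcd(d, p^e) = p^a and from d / p^a,
    which divides m. *)
Lemma divisors_pfactor_le p e m : prime p -> 0 < m ->
  size (divisors (p ^ e * m)) <= e.+1 * size (divisors m).
Proof.
move=> p_pr m0.
have pe0 : 0 < p ^ e by rewrite expn_gt0 prime_gt0.
rewrite -(size_iota 0 e.+1) -(size_allpairs (fun i d => p ^ i * d)).
apply: uniq_leq_size; first exact: divisors_uniq.
move=> d; rewrite -dvdn_divisors ?muln_gt0 ?pe0// => dn.
have [a ea] : exists2 a, a <= e & gcdn d (p ^ e) = p ^ a.
  by apply/dvdn_pfactor => //; exact: dvdn_gcdr.
move=> ga; apply/allpairsP; exists (a, d %/ p ^ a); split => /=.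
- by rewrite (mem_iota 0 e.+1 a) add0n ltnS.
- rewrite -dvdn_divisors// -ga.
  rewrite -(@Gauss_dvdr _ (p ^ e %/ gcdn d (p ^ e))); last first.
    by rewrite /coprime -(@eqn_pmul2r (gcdn d (p ^ e))) ?gcdn_gt0 ?pe0 ?orbT//
      muln_gcdl !divnK ?dvdn_gcdl ?dvdn_gcdr// mul1n.
  by rewrite -(@dvdn_pmul2l (gcdn d (p ^ e))) ?gcdn_gt0 ?pe0 ?orbT//
    mulnA ![gcdn _ _ * _]mulnC !divnK ?dvdn_gcdl ?dvdn_gcdr//.
- by rewrite mulnC divnK// -ga dvdn_gcdl.
Qed.

(** With q the integer part of e/r, e + 1 <= r (q + 1) <= r 2^q; then take r-th powers. This is the
    cost of one small prime in the divisor bound. *)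
Lemma expn_le_exp2 r e : 0 < r -> e.+1 ^ r <= r ^ r * 2 ^ e.
Proof.
move=> r0; have : e.+1 <= r * 2 ^ (e %/ r).
  rewrite (@leq_trans (r * (e %/ r).+1))//; first by rewrite mulnC ltn_ceil.
  by rewrite leq_mul2l ltn_expl// orbT.
move=> h; apply: leq_trans (_ : (r * 2 ^ (e %/ r)) ^ r <= _).
  by rewrite leq_exp2r.
by rewrite expnMn -expnM leq_mul2l leq_exp2l// leq_trunc_div orbT.
Qed.

(** A prime p >= 2^r costs nothing, since (e + 1)^r <= 2^(e r) <= p^e. A smaller prime costs at most
    a factor r^r, and there are fewer than 2^r of them. *)
Lemma divisor_bound r : 0 < r ->
  exists2 K, 0 < K & forall n, 0 < n -> size (divisors n) ^ r <= K * n.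
Proof.
move=> r0; pose B := 2 ^ r; pose c := r ^ r.
have c0 : 0 < c by rewrite expn_gt0 r0.
have split_pfactor p n : prime p -> 0 < n -> p %| n -> exists e m,
    [/\ n = p ^ e * m, 0 < e, 0 < m, ~~ (p %| m) & m < n].
  move=> p_pr n0 pn; have [m pm nE] := pfactor_coprime p_pr n0.
  have e0 : 0 < logn p n by rewrite logn_gt0 mem_primes p_pr n0.
  have m0 : 0 < m by move: n0; rewrite nE; case: m {pm nE}.
  exists (logn p n), m; split => //; first by rewrite mulnC.
    by rewrite -prime_coprime.
  rewrite [X in _ < X]nE -[X in X < _]muln1 ltn_pmul2l//.
  by rewrite -(expn0 p) ltn_exp2l// prime_gt1.
have large n : 0 < n -> (forall p, prime p -> p %| n -> B <= p) ->
    size (divisors n) ^ r <= n.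
  elim/ltn_ind: n => n IH n0 hn.
  have [n1|n1] := leqP n 1.
    have -> : n = 1 by lia.
    by rewrite exp1n.
  have [e [m [nE e0 m0 pm mn]]] :=
    split_pfactor _ _ (pdiv_prime n1) n0 (pdiv_dvd n).
  have /= {}IH : size (divisors m) ^ r <= m.
    by apply: IH => // p pp pdm; apply: hn => //; rewrite nE dvdn_mull.
  rewrite [X in divisors X]nE.
  apply: leq_trans (_ : (e.+1 * size (divisors m)) ^ r <= _).
    by rewrite leq_exp2r// divisors_pfactor_le// pdiv_prime.
  rewrite expnMn [X in _ <= X]nE leq_mul//.
  have Bp : B <= pdiv n by apply: hn; rewrite ?pdiv_prime ?pdiv_dvd.
  apply: leq_trans (_ : B ^ e <= _); last by rewrite leq_exp2r.
  by rewrite /B -expnM mulnC expnM leq_exp2r// ltn_expl.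
exists (c ^ B); first by rewrite expn_gt0 c0.
(* The least admissible prime is lowered from [B] one unit at a time; the only new candidate
   [B - i.+1] is split off if it is prime and divides n, at the price of one factor [c]. *)
suff small i n : 0 < n -> (forall p, prime p -> p %| n -> B - i <= p) ->
    size (divisors n) ^ r <= c ^ i * n.
  by move=> n n0; apply: small => // p _ _; rewrite subnn.
elim: i n => [|i IH] n n0 hn; first by rewrite mul1n large// -(subn0 B).
have IH' m : 0 < m -> (forall p, prime p -> p %| m -> B - i <= p) ->
    size (divisors m) ^ r <= c ^ i.+1 * m.
  move=> m0 /(IH _ m0)/leq_trans; apply.
  by rewrite leq_mul2r leq_pexp2l ?orbT.
pose j := B - i.+1.
have [/andP[j_pr jn]|hj] := boolP (prime j && (j %| n)); last first.
  apply: IH' => // p pp pn; have := hn p pp pn; rewrite leq_eqVlt => /orP[|]; last lia.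
  by move=> /eqP jE; move: hj; rewrite /j jE pp pn.
have [e [m [nE e0 m0 jm mn]]] := split_pfactor _ _ j_pr n0 jn.
have {}IH : size (divisors m) ^ r <= c ^ i * m.
  apply: IH => // p pp pm.
  have : j <= p by apply: hn; rewrite // nE dvdn_mull.
  rewrite leq_eqVlt => /orP[/eqP jp|]; last by rewrite /j; lia.
  by move: jm; rewrite jp pm.
rewrite [X in divisors X]nE.
apply: leq_trans (_ : (e.+1 * size (divisors m)) ^ r <= _).
  by rewrite leq_exp2r// divisors_pfactor_le.
rewrite expnMn; apply: leq_trans (leq_mul (expn_le_exp2 e r0) IH) _.
rewrite expnS -/c [X in _ <= _ * X]nE.
have : 2 ^ e <= j ^ e by rewrite leq_exp2r// prime_gt1.
move=> /(leq_mul (leqnn (c * (c ^ i * m)))).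
by congr (_ <= _); ring.
Qed.

Local Open Scope ring_scope.

(** * Integral linear relations of bounded height *)

(** The bound varies with the column because the columns that carry x are larger by a factor N than
    the pure powers of u. *)
Lemma det_norm_le n (A : 'M[int]_n) (c : 'I_n -> int) :
  (forall i j, `|A i j| <= c j) -> `|\det A| <= n`!%:R * \prod_j c j.
Proof.
move=> Ac; rewrite /determinant (le_trans (ler_norm_sum _ _ _))//.
rewrite -card_Sn mulr_natl -sumr_const [leRHS](eq_bigl xpredT)//.
apply: ler_sum => s _; rewrite normrM normr_sign mul1r normr_prod.
rewrite [leRHS](reindex_inj (@perm_inj _ s)) /=.
by apply: ler_prod => i _; rewrite normr_ge0 Ac.
Qed.

Lemma det_norm_le_cst n (A : 'M[int]_n) (z : int) :
  (forall i j, `|A i j| <= z) -> `|\det A| <= n`!%:R * z ^+ n.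
Proof.
by move=> /det_norm_le; rewrite prodr_const card_ord.
Qed.

(* If g is a nonzero minor of maximal size, every bordering of it vanishes, and
   the coefficients are the cofactors of the expansion along the added row. *)
Lemma bounded_dependency (T : eqType) (e : nat -> T -> int) (S : seq T)
    (z : int) (n : nat) : 1 <= z ->
  (forall j u, (j < n)%N -> u \in S -> `|e j u| <= z) ->
  (forall g : 'I_n -> T, (forall i, g i \in S) ->
     \det (\matrix_(i, j) e j (g i)) = 0) ->
  exists v : nat -> int, [/\ exists2 j, (j < n)%N & v j != 0,
    forall j, `|v j| <= n`!%:R * z ^+ n &
    forall u, u \in S -> \sum_(j < n) v j * e j u = 0].
Proof.
move=> z1; elim: n => [|n IH] ez det0.
  have g : 'I_0 -> T by case.
  have := det0 g; rewrite det_mx00 => /(_ _)/eqP.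
  by rewrite oner_eq0 => /(_ _)/notF[]; case.
have bound_le : n`!%:R * z ^+ n <= n.+1`!%:R * z ^+ n.+1.
  rewrite ler_pM ?exprn_ge0 ?ler0n// ?(le_trans ler01)//.
    by rewrite ler_nat leq_fact.
  by rewrite ler_weXn2l.
have [all0|] := pselect (forall g : 'I_n -> T, (forall i, g i \in S) ->
     \det (\matrix_(i, j) e j (g i)) = 0).
  have [|v [[j jn vj] vz vS]] := IH _ all0.
    by move=> j u jn uS; apply: ez => //; exact: ltnW.
  exists (fun j => if (j < n)%N then v j else 0); split.
  - by exists j; [exact: ltnW|rewrite jn].
  - move=> i; case: ifP => _; first exact: le_trans (vz _) _.
    by rewrite normr0 (le_trans _ bound_le)// (le_trans _ (vz 0%N)).
  - move=> u uS; rewrite big_ord_recr /= ltnn mul0r addr0 -[RHS](vS u uS).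
    by apply: eq_bigr => i _; rewrite ltn_ord.
move=> /existsNP[g /not_implyP[gS gdet]].
pose v (j : nat) : int :=
  (-1) ^+ (n + j) * \det (\matrix_(i < n, l < n) e (bump j l) (g i)).
exists v; split.
- exists n => //; rewrite /v mulf_neq0 ?signr_eq0//; apply/eqP.
  move=> h; apply: gdet; rewrite -[RHS]h; congr (\det _).
  by apply/matrixP => i j; rewrite !mxE /bump leqNgt ltn_ord.
- move=> j; rewrite /v normrM normrX normrN1 expr1n mul1r.
  apply: le_trans (det_norm_le_cst (z := z) _) bound_le => i l.
  rewrite mxE ez//; rewrite /bump; have := ltn_ord l; case: leqP => //; lia.
- move=> u uS.
  pose g' (i : 'I_n.+1) := if unlift ord_max i is Some i' then g i' else u.
  have g'S i : g' i \in S by rewrite /g'; case: (unlift _ _).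
  rewrite -[RHS](det0 g' g'S) (expand_det_row _ ord_max).
  apply: eq_bigr => j _; rewrite !mxE /g' unlift_none mulrC; congr (_ * _).
  rewrite /v /cofactor; congr (_ * \det _).
  by apply/matrixP => i l; rewrite !mxE liftK.
Qed.

Lemma leq_expn m n e : (m <= n -> m ^ e <= n ^ e)%N.
Proof. by case: e => // e mn; rewrite leq_exp2r. Qed.

Lemma prod_if_lt (a n : nat) (c d : int) : (a <= n)%N ->
  \prod_(j < n) (if (j < a)%N then c else d) = c ^+ a * d ^+ (n - a).
Proof.
move=> an; rewrite -(big_mkord xpredT (fun j => if (j < a)%N then c else d)).
rewrite (big_cat_nat (n := a))//=; congr (_ * _).
  rewrite big_nat (eq_bigr (fun=> c)) => [|i /andP[_ ->]//].
  by rewrite -big_nat prodr_const_nat subn0.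
rewrite big_nat (eq_bigr (fun=> d)) => [|i /andP[ai _]]; last by rewrite ltnNge ai.
by rewrite -big_nat prodr_const_nat.
Qed.

(** * Curves P(u) + x Q(u) = 0 through a set of points *)

Section Relations.
Variable x : nat -> nat.

(** The order 1, u, u^2, x, x u, x u^2, ... makes the first b + 4 monomials span the P + x Q with
    deg P <= 2 and deg Q <= b, so lowering deg Q only cuts off the end of the list. *)
Definition xmonomial (j u : nat) : int :=
  if (j < 3)%N then u%:Z ^+ j else (x u)%:Z * u%:Z ^+ (j - 3).

Definition xrel (S : seq nat) (P Q : {poly int}) : Prop :=
  forall u, u \in S -> P.[u%:Z] + (x u)%:Z * Q.[u%:Z] = 0.

Lemma sum_xmonomial (v : nat -> int) b u :
  \sum_(j < b.+4) v j * xmonomial j u =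
  (\poly_(i < 3) v i).[u%:Z] + (x u)%:Z * (\poly_(i < b.+1) v i.+3).[u%:Z].
Proof.
rewrite !horner_poly [LHS](@big_split_ord _ _ _ 3 b.+1) /=; congr (_ + _).
  by apply: eq_bigr => i _; rewrite /xmonomial ltn_ord.
rewrite mulr_sumr; apply: eq_bigr => i _.
by rewrite /xmonomial /= addnC addn3 subSS subSS subn1 mulrCA.
Qed.

(** The coefficients of P and Q form a kernel vector common to all these matrices. Combined with
    [bounded_xrel], this replaces a relation of uncontrolled height by one of bounded height and the
    same degree bounds. *)
Lemma det_of_xrel (S : seq nat) (P Q : {poly int}) b (g : 'I_b.+4 -> nat) :
  (size P <= 3)%N -> (size Q <= b.+1)%N -> (P != 0) || (Q != 0) ->
  xrel S P Q -> (forall i, g i \in S) ->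
  \det (\matrix_(i, j) xmonomial j (g i)) = 0.
Proof.
move=> sP sQ PQ0 rPQ gS; apply/eqP; rewrite -det_tr; apply/det0P.
pose v j := if (j < 3)%N then P`_j else Q`_(j - 3).
have vP : \poly_(i < 3) v i = P.
  apply/polyP => i; rewrite coef_poly /v; case: ltnP => // ?.
  by rewrite nth_default// (leq_trans sP).
have vQ : \poly_(i < b.+1) v i.+3 = Q.
  apply/polyP => i; rewrite coef_poly /v /= subSS subSS subn1 /=.
  by case: ltnP => // ?; rewrite nth_default// (leq_trans sQ).
exists (\row_j v j).
  apply: contraTneq PQ0 => /rowP v0.
  have {}v0 j : (j < b.+4)%N -> v j = 0.
    by move=> jb; have := v0 (Ordinal jb); rewrite !mxE.
  rewrite negb_or !negbK -vP -vQ; apply/andP; split; apply/eqP/polyP => i;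
    by rewrite coef_poly coef0; case: ifP => // ib; apply: v0; lia.
apply/rowP => i; rewrite !mxE -[RHS](rPQ _ (gS i)) -vP -vQ.
by rewrite -sum_xmonomial; apply: eq_bigr => j _; rewrite !mxE.
Qed.

Lemma bounded_xrel (S : seq nat) b (z : int) : 1 <= z ->
  (forall j u, (j < b.+4)%N -> u \in S -> `|xmonomial j u| <= z) ->
  (forall g : 'I_b.+4 -> nat, (forall i, g i \in S) ->
     \det (\matrix_(i, j) xmonomial j (g i)) = 0) ->
  exists P Q : {poly int},
    [/\ (size P <= 3)%N, (size Q <= b.+1)%N, (P != 0) || (Q != 0), xrel S P Q &
      forall i, `|P`_i| <= b.+4`!%:R * z ^+ b.+4 /\
                `|Q`_i| <= b.+4`!%:R * z ^+ b.+4].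
Proof.
move=> z1 ez /(bounded_dependency z1 ez)[v [[j jb vj] vz vS]].
have B0 : 0 <= b.+4`!%:R * z ^+ b.+4 by apply: le_trans (vz 0%N).
exists (\poly_(i < 3) v i), (\poly_(i < b.+1) v i.+3).
split; rewrite ?size_poly//; last 2 first.
- by move=> u uS; rewrite -sum_xmonomial vS.
- by move=> i; rewrite !coef_poly; split; case: ifP; rewrite ?normr0.
apply: contraNT vj; rewrite negb_or !negbK => /andP[/eqP/polyP P0 /eqP/polyP Q0].
have [j3|j3] := ltnP j 3.
  by have := P0 j; rewrite coef_poly coef0 j3 => ->.
have := Q0 (j - 3)%N; rewrite coef_poly coef0.
have -> : ((j - 3).+3 = j)%N by lia.
by case: ifP => [_ ->//|]; lia.
Qed.

End Relations.

(** * The determinant of the monomials: divisibility against size *)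

Section PadicDeterminant.
Variables (k p y0 : nat) (C : int) (x : nat -> nat).

(* Column operations replacing x u^(k+i) by u^i (x (y0 + u)^k + C), for i < 3. *)
Let colop : 'M[int]_(k.+3 + 3) := \matrix_(l, j)
  if (j < k.+3)%N then (l == j)%:R
  else if (l < 3)%N then C * (l == (j - k.+3)%N :> nat)%:R
  else (('X + y0%:Z%:P) ^+ k * 'X^(j - k.+3))`_(l - 3).

Let size_shift_exp : size (('X + y0%:Z%:P) ^+ k : {poly int}) = k.+1.
Proof. by rewrite -[y0%:Z]opprK polyCN size_exp_XsubC. Qed.

(** The polynomial (X + y0)^k X^i is monic of degree k + i, and its leading coefficient falls on the
    diagonal entry k + 3 + i, so the matrix is unitriangular. *)
Lemma det_colop : \det colop = 1.
Proof.
rewrite -det_tr det_trig; last first.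
  apply/is_trig_mxP => j l jl; rewrite !mxE.
  case: ifPn => [_|]; first by rewrite -val_eqE /= gtn_eqF.
  rewrite -leqNgt => kj; case: ifP => [|_]; first lia.
  rewrite coefMXn; case: ifP => // h.
  by rewrite nth_default// size_shift_exp; lia.
rewrite big1// => j _; rewrite !mxE eqxx; case: ifPn => //.
rewrite -leqNgt => kj; case: ifP => [|_]; first lia.
rewrite coefMXn ifF; last by apply/negbTE; lia.
have -> : (j - 3 - (j - k.+3) = (size (('X + y0%:Z%:P) ^+ k : {poly int})).-1)%N.
  by rewrite size_shift_exp; lia.
rewrite -/(lead_coef _) lead_coef_exp -[y0%:Z]opprK polyCN lead_coefXsubC.
by rewrite expr1n.
Qed.

(** After the unimodular column operations, the last three columns have entries u^i (x (y0 + u)^k +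
    C), all multiples of p^k. The factor p^(3k) is the determinant of [diag_mx d]. *)
Lemma dvdz_det_xmonomial (g : 'I_(k.+3 + 3) -> nat) :
  (forall i, ((p ^ k)%N%:Z %| (x (g i))%:Z * (y0 + g i)%N%:Z ^+ k + C)%Z) ->
  ((p ^ (3 * k))%N%:Z %| \det (\matrix_(i, j) xmonomial x j (g i)))%Z.
Proof.
move=> pg; set M := \matrix_(i, j) _.
pose q := (p ^ k)%N%:Z; pose d : 'rV[int]_(k.+3 + 3) := \row_j if (j < k.+3)%N then 1 else q.
have -> : \det M = \det (M *m colop) by rewrite det_mulmx det_colop mulr1.
have -> : M *m colop =
    (\matrix_(i, j) ((M *m colop) i j %/ d ord0 j)%Z) *m diag_mx d.
  apply/matrixP => i j; rewrite mul_mx_diag !mxE divzK//.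
  case: ifPn => [_|]; first by rewrite dvd1z.
  rewrite -leqNgt => kj.
  have [jj|jj] := leqP 3 (j - k.+3); first by have := ltn_ord j; lia.
  suff -> : \sum_j0 M i j0 * colop j0 j = (g i)%:Z ^+ (j - k.+3) *
     ((x (g i))%:Z * (y0 + g i)%N%:Z ^+ k + C) by rewrite dvdz_mull.
  pose v l := if (l < 3)%N then C * (l == (j - k.+3)%N :> nat)%:R
    else (('X + y0%:Z%:P) ^+ k * 'X^(j - k.+3))`_(l - 3).
  transitivity (\sum_(l < k.+2.+4) v l * xmonomial x l (g i)).
    have -> : (k.+2.+4 = k.+3 + 3)%N by rewrite addnC.
    by apply: eq_bigr => l _; rewrite !mxE mulrC ltnNge kj.
  rewrite sum_xmonomial.
  have -> : \poly_(l < 3) v l = C *: 'X^(j - k.+3).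
    apply/polyP => l; rewrite coef_poly coefZ coefXn /v; case: ltnP => // l3.
    by rewrite gtn_eqF ?mulr0// (leq_trans jj).
  have -> : \poly_(l < k.+3) v l.+3 = ('X + y0%:Z%:P) ^+ k * 'X^(j - k.+3).
    apply/polyP => l; rewrite coef_poly /v /= subSS subSS subn1 /=.
    case: ltnP => // kl; rewrite nth_default// (leq_trans (size_polyMleq _ _))//.
    by rewrite size_shift_exp size_polyXn; lia.
  rewrite !hornerE PoszD [y0%:Z + _]addrC /=; move: (_ ^+ (j - _)) (_ ^+ k) => a b; ring.
rewrite det_mulmx det_diag dvdz_mull//.
under eq_bigr do rewrite mxE.
rewrite prod_if_lt ?leq_addr// expr1n mul1r addKn /q.
by rewrite -[(p ^ k)%N%:Z]natz -natrX -expnM mulnC natz.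
Qed.

(** Each of the k + 6 columns is at most L^(k+2), with a further factor N in the k + 3 columns that
    carry x. The hypothesis makes the determinant smaller than the power of p that divides it. *)
Lemma det_xmonomial_eq0 (N L : nat) (g : 'I_(k.+3 + 3) -> nat) :
  (0 < L)%N -> (forall i, g i < L)%N -> (forall i, x (g i) <= N)%N ->
  ((k.+3 + 3)`! * (L ^ (k.+2 * (k + 6)) * N ^ k.+3) < p ^ (3 * k))%N ->
  (forall i, ((p ^ k)%N%:Z %| (x (g i))%:Z * (y0 + g i)%N%:Z ^+ k + C)%Z) ->
  \det (\matrix_(i, j) xmonomial x j (g i)) = 0.
Proof.
move=> L0 gL gN Hp pg; have := dvdz_det_xmonomial pg.
set D := \det _ => pD; apply/eqP; rewrite -absz_eq0; apply/eqP.
have DB : (`|D| < p ^ (3 * k))%N.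
  apply: leq_ltn_trans Hp; rewrite -lez_nat abszE.
  pose c (j : 'I_(k.+3 + 3)) : int :=
    if (j < 3)%N then (L ^ k.+2)%N%:Z else (L ^ k.+2 * N)%N%:Z.
  apply: le_trans (@det_norm_le _ _ c _) _ => [i j|]; last first.
    rewrite prod_if_lt ?leq_addl//.
    rewrite -!natz -!natrX -!natrM ler_nat leq_mul2l; apply/orP; right.
    have -> : (k.+3 + 3 - 3 = k.+3)%N by lia.
    rewrite expnMn mulnA -expnD -expnM.
    by have -> : (3 + k.+3 = k + 6)%N by lia.
  rewrite mxE /xmonomial /c; case: ifP => j3.
    rewrite -[(g i)%:Z]natz -natrX normr_nat natz lez_nat.
    rewrite (leq_trans (leq_expn j (ltnW (gL i))))// leq_pexp2l//; lia.
  rewrite -[(g i)%:Z]natz -natrX -[(x _)%:Z]natz -natrM normr_nat natz lez_nat.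
  rewrite mulnC leq_mul//.
  rewrite (leq_trans (leq_expn _ (ltnW (gL i))))// leq_pexp2l//.
  by have := ltn_ord j; lia.
have [//|D0] := posnP `|D|%N.
by move: pD; rewrite dvdzE absz_nat => /(dvdn_leq D0); lia.
Qed.

End PadicDeterminant.

(** * Solutions of a congruence modulo p^k in a short window *)

(** The entries of the Sylvester matrix are coefficients of P or Q, or zero. *)
Lemma resultant_norm_le (P Q : {poly int}) (z : int) :
  (forall i, `|P`_i| <= z) -> (forall i, `|Q`_i| <= z) ->
  `|resultant P Q| <=
    ((size Q).-1 + (size P).-1)%N`!%:R * z ^+ ((size Q).-1 + (size P).-1).
Proof.
move=> Pz Qz; apply: det_norm_le_cst => i j.
have z0 : 0 <= z := le_trans (normr_ge0 _) (Pz 0%N).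
have shift_le (W : {poly int}) n (l : 'I_n) (m : nat) :
    (forall i, `|W`_i| <= z) -> `|(rVpoly (delta_mx 0 l : 'rV_n) * W)`_m| <= z.
  by move=> Wz; rewrite rVpoly_delta coefXnM; case: ifP; rewrite ?normr0.
by rewrite mxE; case: (split i) => l; rewrite !mxE /=; apply: shift_le.
Qed.

Lemma natz_inj : injective (fun n : nat => n%:Z).
Proof. by move=> m n []. Qed.

Lemma size_poly_roots (W : {poly int}) (S : seq nat) : W != 0 -> uniq S ->
  (forall u, u \in S -> W.[u%:Z] = 0) -> (size S < size W)%N.
Proof.
move=> W0 uS WS; rewrite -(size_map (fun n : nat => n%:Z)).
apply: max_poly_roots => //; last by rewrite (map_inj_uniq natz_inj).
by apply/allP => _ /mapP[u uS' ->]; apply/rootP/WS.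
Qed.

Lemma size_value_fibre (W : {poly int}) (S : seq nat) (c : int) :
  (1 < size W)%N -> uniq S ->
  (size [seq u <- S | W.[u%:Z] == c] < size W)%N.
Proof.
move=> W1 uS; have sWc : size (W - c%:P) = size W.
  by rewrite size_polyDl// size_polyN (leq_ltn_trans (size_polyC_leq1 _)).
rewrite -sWc; apply: size_poly_roots; last 2 first.
- exact: filter_uniq.
- by move=> u; rewrite mem_filter => /andP[/eqP Wu _]; rewrite !hornerE Wu subrr.
by rewrite -size_poly_gt0 sWc; exact: ltnW.
Qed.

(** Each value is d or -d with d a divisor of r, and each value is taken at most deg W times; the
    factor 2 accounts for the sign. *)
Lemma size_dividing_values (W : {poly int}) (S : seq nat) (r : int) :
  (1 < size W)%N -> r != 0 -> uniq S ->
  (forall u, u \in S -> (W.[u%:Z] %| r)%Z) ->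
  (size S <= size (divisors `|r|) * (2 * (size W).-1))%N.
Proof.
move=> W1 r0 uS WS.
pose D := divisors `|r|.
have SD u : u \in S -> `|W.[u%:Z]|%N \in D.
  by move=> /WS; rewrite -dvdn_divisors// absz_gt0.
rewrite -(count_predT S) -sum1_count.
apply: (@leq_trans (\sum_(u <- S) \sum_(d <- D) (`|W.[u%:Z]|%N == d))).
  rewrite big_seq [leqRHS]big_seq; apply: leq_sum => u /SD uD.
  by rewrite (big_rem _ uD) /= eqxx.
rewrite exchange_big /= -sum1_size big_distrl /=.
apply: leq_sum => d _; rewrite mul1n.
have -> : (\sum_(u <- S) (`|W.[u%:Z]|%N == d) = count (fun u => `|W.[u%:Z]|%N == d) S)%N.
  by rewrite -sum1_count [RHS]big_mkcond; apply: eq_bigr => u _; case: eqP.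
apply: leq_trans (_ : count (fun u => W.[u%:Z] == d%:Z) S +
   count (fun u => W.[u%:Z] == - d%:Z) S <= _)%N.
  rewrite -count_predUI (leq_trans _ (leq_addr _ _))//.
  apply: sub_count => u /= /eqP <-; case: (W.[u%:Z]) => n /=; first by rewrite eqxx.
  by rewrite NegzE eqxx ?orbT.
have fib c : (count (fun u => W.[u%:Z] == c) S <= (size W).-1)%N.
  by rewrite -size_filter -ltnS prednK ?size_value_fibre// ltnW.
by rewrite mul2n -addnn leq_add.
Qed.

(** * Relations with constant Q, studied modulo p *)

Section ModP.
Variables (k p y0 : nat) (C : int) (x : nat -> nat).
Hypotheses (p_pr : prime p) (pC : ~~ (p%:Z %| C)%Z) (k_gt0 : (0 < k)%N).

Let iF (c : int) : 'F_p := c%:~R.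

Let iF_eq0 (c : int) : (iF c == 0) = (p%:Z %| c)%Z.
Proof.
by rewrite dvdzE (dvdn_pcharf (pchar_Fp p_pr)) /iF; case: c => n //=;
  rewrite ?NegzE ?mulrNz ?oppr_eq0.
Qed.

(** Descent on |q|. If p does not divide q, eliminating x between the relation and the congruence
    gives a nonzero polynomial of degree at most k + 2 modulo p that vanishes on S; the points are
    distinct modulo p because u < p. If p divides q, then P vanishes modulo p on S, so either S is
    small or P is zero modulo p, and the whole relation can be divided by p. *)
Lemma size_integral_graph (S : seq nat) (P : {poly int}) (q : int) :
  uniq S -> (forall u, u \in S -> (u < p)%N) -> (size P <= 3)%N -> q != 0 ->
  (forall u, u \in S -> P.[u%:Z] + (x u)%:Z * q = 0) ->
  (forall u, u \in S -> (p%:Z %| (x u)%:Z * (y0 + u)%N%:Z ^+ k + C)%Z) ->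
  (size S <= k + 2)%N.
Proof.
move=> uS Sp; have [n] := ubnP `|q|%N; elim: n q P => // n IH q P qn sP q0 rel dvS.
have modp_roots (W : {poly 'F_p}) : W != 0 ->
    (forall u, u \in S -> W.[u%:R] = 0) -> (size S < size W)%N.
  move=> W0 WS; rewrite -(size_map (fun n : nat => n%:R : 'F_p)).
  apply: max_poly_roots => //.
    by apply/allP => _ /mapP[u uS' ->]; apply/rootP/WS.
  rewrite map_inj_in_uniq// => u v uS' vS' /(congr1 val) /=.
  by rewrite !val_Fp_nat ?prime_gt1// !modn_small ?Sp.
pose Pp := map_poly iF P.
have sPp : (size Pp <= 3)%N by rewrite (leq_trans (size_poly _ _)).
have relp u : u \in S -> Pp.[u%:R] = - ((x u)%:R * iF q).
  move=> /rel/eqP; rewrite addr_eq0 => /eqP/(congr1 iF).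
  rewrite /Pp /iF -[u%:R]/((u%:Z)%:~R) (horner_map intr) /= => ->.
  by rewrite mulrNz intrM.
have [pq|pq] := boolP (p%:Z %| q)%Z; last first.
  (* P Y^k - C q vanishes mod p on S, but is not zero as C q is a unit. *)
  pose W := Pp * ('X + (y0%:R)%:P) ^+ k - (iF (C * q))%:P.
  have W0 : W != 0.
    apply/eqP => /(congr1 (fun W => W.[- y0%:R])) /eqP.
    rewrite !hornerE addNr expr0n eqn0Ngt k_gt0 mulr0 add0r oppr_eq0 iF_eq0.
    rewrite /iF.
    have := iF_eq0 (C * q); rewrite /iF intrM mulf_eq0 !iF_eq0 (negbTE pC) (negbTE pq).
    by move=> <-.
  have WS u : u \in S -> W.[u%:R] = 0.
    move=> uS'; rewrite !hornerE relp//; have := dvS u uS'; rewrite -iF_eq0.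
    rewrite /iF rmorphD /= rmorphM rmorphXn /= PoszD rmorphD /=.
    rewrite addr_eq0 => /eqP xC.
    rewrite rmorphM /= -[C%:~R]opprK -xC -[(y0%:Z)%:~R]/(y0%:R) -[(u%:Z)%:~R]/(u%:R).
    rewrite [u%:R + _]addrC -[((x u)%:Z)%:~R]/((x u)%:R).
    by move: (_ ^+ k) => a; ring.
  have := modp_roots _ W0 WS => sSW.
  rewrite -ltnS (leq_trans sSW)// (leq_trans (size_polyD _ _))// geq_max.
  rewrite size_polyN (leq_trans (size_polyC_leq1 _)) ?andbT//.
  apply: leq_trans (size_polyMleq _ _) _.
  have -> : size (('X + (y0%:R)%:P) ^+ k : {poly 'F_p}) = k.+1.
    by rewrite -[y0%:R]opprK polyCN size_exp_XsubC.
  by move: sPp; move: (size _) => s; lia.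
have [Sk//|Sk] := leqP (size S) (k + 2).
have Pp0 : Pp = 0.
  apply/eqP; apply: contraT => Pp0; have := modp_roots _ Pp0 _.
  suff: forall u, u \in S -> Pp.[u%:R] = 0 
    by move=> h /(_ h) sS; have := leq_trans sS sPp; move: (size S) Sk; lia.
  by move=> u /relp ->; move: pq; rewrite -iF_eq0 => /eqP ->; rewrite mulr0 oppr0.
have pP i : (p%:Z %| P`_i)%Z.
  by rewrite -iF_eq0 /iF -(coef_map intr) -/iF -/Pp Pp0 coef0.
pose P' := \poly_(i < 3) (P`_i %/ p%:Z)%Z.
have PP' : P = p%:Z *: P'.
  apply/polyP => i; rewrite coefZ coef_poly; case: ltnP => i3.
    by rewrite mulrC divzK.
  by rewrite mulr0 nth_default// (leq_trans sP).
have qq' : q = p%:Z * (q %/ p%:Z)%Z by rewrite mulrC divzK.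
have p0 : p%:Z != 0 by rewrite -lt0n prime_gt0.
suff: (size S <= k + 2)%N by rewrite leqNgt Sk.
apply: (IH (q %/ p%:Z)%Z P' _ _ _ _ dvS).
- rewrite (leq_trans _ (qn : (_ <= n)%N))// [X in (_ < `|X|)%N]qq'.
  rewrite abszM ltn_Pmull ?prime_gt1// absz_gt0.
  by apply: contraNneq q0 => h; rewrite qq' h mulr0.
- exact: size_poly.
- by apply: contraNneq q0 => h; rewrite qq' h mulr0.
- move=> u /rel; rewrite PP' hornerZ {1}qq' mulrCA -mulrDr => /eqP.
  by rewrite mulf_eq0 (negbTE p0) => /eqP.
Qed.

End ModP.

(** * Number of solutions in one window *)

Section Cluster.
Variables (k p y0 N L Delta : nat) (C : int) (x : nat -> nat).
Hypotheses (p_pr : prime p) (pC : ~~ (p%:Z %| C)%Z) (k_gt0 : (0 < k)%N).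
Hypotheses (L_gt0 : (0 < L)%N) (Lp : (L <= p)%N) (N_gt0 : (0 < N)%N).

(** Heights: [z] bounds the monomials and [Z] the coefficients of P and Q. The range of [DeltaP]
    covers the resultant, whose Sylvester matrix has order at most 2 + (k + 2). *)
Let z := (L ^ k.+2 * N)%N.
Let Z := ((k + 6)`! * z ^ (k + 6))%N.

Hypothesis DeltaP : forall n, (0 < n)%N ->
  (n <= (k + 4)`! * Z ^ (k + 4))%N -> (size (divisors n) <= Delta)%N.

Definition cluster (S : seq nat) := forall u, u \in S ->
  [/\ (u < L)%N, (x u <= N)%N &
      ((p ^ k)%N%:Z %| (x u)%:Z * (y0 + u)%N%:Z ^+ k + C)%Z].

Let z_gt0 : (0 < z)%N. Proof. by rewrite muln_gt0 expn_gt0 L_gt0. Qed.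
Let Z_gt0 : (0 < Z)%N. Proof. by rewrite muln_gt0 fact_gt0 expn_gt0 z_gt0. Qed.

Let xmonomial_le S j u : cluster S -> u \in S -> (j < k.+2.+4)%N ->
  `|xmonomial x j u| <= z%:Z.
Proof.
move=> cS /cS[uL xN _] jk.
have uj i : (i <= k.+2)%N -> (u ^ i <= L ^ k.+2)%N.
  by move=> ik; rewrite (leq_trans (leq_expn i (ltnW uL)))// leq_pexp2l.
rewrite /xmonomial; case: ifP => j3.
  rewrite -[u%:Z]natz -natrX normr_nat natz lez_nat.
  by rewrite (leq_trans (uj _ _)) ?leq_pmulr//; lia.
rewrite -[u%:Z]natz -natrX -[(x u)%:Z]natz -natrM normr_nat natz lez_nat.
by rewrite mulnC leq_mul// uj//; lia.
Qed.

Let bounded_cluster_xrel S b : (b <= k.+2)%N -> cluster S ->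
  (forall g : 'I_b.+4 -> nat, (forall i, g i \in S) ->
     \det (\matrix_(i, j) xmonomial x j (g i)) = 0) ->
  exists P Q : {poly int},
    [/\ (size P <= 3)%N, (size Q <= b.+1)%N, (P != 0) || (Q != 0), xrel x S P Q &
      forall i, `|P`_i| <= Z%:Z /\ `|Q`_i| <= Z%:Z].
Proof.
move=> bk cS det0; have z1 : 1 <= z%:Z by rewrite lez_nat.
have [j u jb uS|P [Q [sP sQ PQ0 rPQ PQZ]]] := bounded_xrel z1 _ det0.
  by apply: xmonomial_le uS _ => //; lia.
exists P, Q; split => // i; have [Pi Qi] := PQZ i.
have ZZ : b.+4`!%:R * z%:Z ^+ b.+4 <= Z%:Z.
  rewrite -[z%:Z]natz -natrX -natrM natz lez_nat /Z leq_mul//.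
    by rewrite leq_fact//; lia.
  by rewrite leq_pexp2l//; lia.
by split; exact: le_trans ZZ.
Qed.

Let resultant_le (P Q : {poly int}) : (size P <= 3)%N -> (size Q <= k.+3)%N ->
  (forall i, `|P`_i| <= Z%:Z) -> (forall i, `|Q`_i| <= Z%:Z) ->
  (`|resultant P Q| <= (k + 4)`! * Z ^ (k + 4))%N.
Proof.
move=> sP sQ PZ QZ; rewrite -lez_nat abszE.
apply: le_trans (resultant_norm_le PZ QZ) _.
rewrite -[Z%:Z]natz -natrX -natrM natz lez_nat leq_mul//.
  by rewrite leq_fact//; lia.
by rewrite leq_pexp2l//; lia.
Qed.

(* A common factor of P and Q is divided out after dropping its roots from S;
   the quotients need not be bounded, so a bounded relation is chosen anew. *)
Lemma size_cluster_xrel b S (P Q : {poly int}) : (b <= k.+2)%N -> uniq S -> cluster S ->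
  (size P <= 3)%N -> (size Q <= b.+1)%N -> (P != 0) || (Q != 0) ->
  xrel x S P Q -> (size S <= Delta * (2 * k.+2) + k.+3 + b * k.+2)%N.
Proof.
elim/ltn_ind: b S P Q => b IH S P' Q' bk uS cS sP' sQ' PQ'0 rPQ'.
have [|P [Q [sP sQ PQ0 rPQ PQZ]]] := bounded_cluster_xrel bk cS.
  by move=> g; exact: det_of_xrel PQ'0 rPQ'.
have [Q0|Q0] := eqVneq Q 0.
  move: PQ0; rewrite Q0 eqxx orbF => P0.
  have := size_poly_roots P0 uS _ => /(_ _)/leq_trans/(_ sP) h.
  suff: (size S < 3)%N by lia.
  by apply: h => u /rPQ; rewrite Q0 horner0 mulr0 addr0.
pose G := gcdp P Q.
have GQ : G %| Q by exact: dvdp_gcdr.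
have G0 : G != 0 by rewrite gcdp_eq0 negb_and Q0 orbT.
have [G1|G1] := ltnP 1 (size G).
  (* Over the integers, division by G is exact only up to the constants [c1] and [c2], so the new
     relation is cross-multiplied. Its Q has smaller degree, and at most deg G <= k + 2 points are
     dropped; over b rounds this gives the term b (k + 2). *)
  have divG W : G %| W -> exists c : int, c != 0 /\ exists W1, c *: W = W1 * G.
    by case/Pdiv.Idomain.dvdpP => -[c W1] /= c0 ?; exists c; split => //; exists W1.
  have [c1 [c10 [P1 P1E]]] := divG P (dvdp_gcdl P Q).
  have [c2 [c20 [Q1 Q1E]]] := divG Q GQ.
  have Q10 : Q1 != 0.
    apply: contraNneq Q0 => Q10; move: Q1E; rewrite Q10 mul0r => /eqP.
    by rewrite -mul_polyC mulf_eq0 polyC_eq0 (negbTE c20).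
  have sQ1 : (size Q1 + size G = (size Q).+1)%N.
    have -> : (size Q = (size Q1 + size G).-1)%N by rewrite -size_mul// -Q1E size_scale.
    by rewrite prednK// addn_gt0 size_poly_gt0 Q10.
  have sP1 : (size P1 <= 3)%N.
    have [->|P10] := eqVneq P1 0; first by rewrite size_poly0.
    have E : (size P = (size P1 + size G).-1)%N by rewrite -size_mul// -P1E size_scale.
    by move: sP; rewrite E; clear -G1; lia.
  have Q1_gt0 : (0 < size Q1)%N by rewrite size_poly_gt0.
  pose S' := [seq u <- S | G.[u%:Z] != 0].
  have b0 : (0 < b)%N by clear -sQ sQ1 G1 Q1_gt0; lia.
  have /IH/(_ S' (c2 *: P1) (c1 *: Q1)) h : (b.-1 < b)%N by rewrite ltn_predL.
  have {}h : (size S' <= Delta * (2 * k.+2) + k.+3 + b.-1 * k.+2)%N.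
    apply: h; rewrite ?filter_uniq//.
    - by rewrite (leq_trans (leq_pred _)).
    - by move=> u; rewrite mem_filter => /andP[_ /cS].
    - by rewrite size_scale.
    - by rewrite size_scale//; clear -sQ sQ1 G1 b0; lia.
    - by rewrite -!mul_polyC !mulf_eq0 !polyC_eq0 (negbTE c10) (negbTE Q10) orbT.
    - move=> u; rewrite mem_filter => /andP[Gu uS'].
      apply/eqP; rewrite -(mulIr_eq0 _ (mulIf Gu)) !hornerZ; apply/eqP.
      transitivity (c2 * (P1 * G).[u%:Z] + (x u)%:Z * (c1 * (Q1 * G).[u%:Z])).
        by rewrite !hornerM; ring.
      rewrite -P1E -Q1E !hornerZ; have := rPQ u uS'.
      by move=> /(congr1 (fun t => c1 * c2 * t)); rewrite mulr0 => <-; ring.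
  have sS0 : (size [seq u <- S | G.[u%:Z] == 0] < size G)%N.
    apply: size_poly_roots => //; first exact: filter_uniq.
    by move=> u; rewrite mem_filter => /andP[/eqP].
  have : (size S = size S' + size [seq u <- S | G.[u%:Z] == 0])%N.
    by rewrite /S' !size_filter addnC -(count_predC (fun u : nat => G.[u%:Z] == 0)).
  have : (b * k.+2 = b.-1 * k.+2 + k.+2)%N by rewrite -mulSnr prednK.
  have sG : (size G <= k.+3)%N by clear -sQ sQ1 Q1_gt0 bk; lia.
  clear -h sS0 sG; lia.
have [Q1|Q1] := leqP (size Q) 1.
  have [q QE] : exists q, Q = q%:P by exists Q`_0; exact: size1_polyC.
  suff: (size S <= k + 2)%N.
    by clear; move: (Delta * _)%N (b * _)%N => c d; lia.
  apply: (@size_integral_graph k p y0 C x p_pr pC k_gt0 S P q) => //.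
  - by move=> u /cS[uL _ _]; exact: leq_trans Lp.
  - by move: Q0; rewrite QE polyC_eq0.
  - by move=> u /rPQ; rewrite QE hornerC.
  - move=> u /cS[_ _]; apply: dvdz_trans; rewrite dvdzE /=.
    by rewrite dvdn_exp.
(* Now Q is not constant and is coprime to P. The resultant is A P + B Q, and P(u) = - x Q(u) on S,
   so Q(u) divides it. A constant P is treated apart: it is nonzero, since otherwise the gcd would
   be Q, and Q(u) divides it directly. *)
have [r [r0 rR rQ]] : exists r : int, [/\ r != 0,
    (`|r| <= (k + 4)`! * Z ^ (k + 4))%N & forall u, u \in S -> (Q.[u%:Z] %| r)%Z].
  have [P1|P1] := leqP (size P) 1.
    have [c PE] : exists c, P = c%:P by exists P`_0; exact: size1_polyC.
    have c0 : c != 0.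
      apply: contraTneq Q1 => c0; move: G1.
      by rewrite /G PE c0 polyC0 gcd0p -leqNgt.
    exists c; split => //.
      have := (PQZ 0%N).1; rewrite PE coefC eqxx -abszE lez_nat => cZ.
      rewrite (leq_trans cZ)// (leq_trans _ (leq_pmull _ (fact_gt0 _)))//.
      by rewrite addnS expnS leq_pmulr// expn_gt0 Z_gt0.
    move=> u /rPQ/eqP; rewrite PE hornerC addr_eq0 => /eqP ->.
    by rewrite -mulNr dvdz_mull.
  exists (resultant P Q); split.
  - by rewrite resultant_eq0 -leqNgt.
  - apply: resultant_le => //; first exact: leq_trans sQ _.
      by move=> i; exact: (PQZ i).1.
    by move=> i; exact: (PQZ i).2.
  - have [[A B] /= _ RE] := resultant_in_ideal P1 Q1.
    move=> u /rPQ/eqP; rewrite addr_eq0 => /eqP Pu.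
    move: RE => /(congr1 (fun W => W.[u%:Z])); rewrite hornerC !hornerE Pu => ->.
    by rewrite -mulNr mulrA -mulrDl dvdz_mull.
have := size_dividing_values Q1 r0 uS rQ.
have := DeltaP _ rR; rewrite absz_gt0 => /(_ r0) rD.
move=> /leq_trans; apply; rewrite -addnA (leq_trans _ (leq_addr _ _))//.
by rewrite leq_mul// leq_mul2l /= -ltnS prednK ?(leq_trans sQ)// ltnW.
Qed.

Lemma size_cluster S : uniq S -> cluster S ->
  ((k + 6)`! * (L ^ (k.+2 * (k + 6)) * N ^ k.+3) < p ^ (3 * k))%N ->
  (size S <= Delta * (2 * k.+2) + k.+3 + k.+2 * k.+2)%N.
Proof.
move=> uS cS Hp.
have det0 n (g : 'I_n -> nat) : n = (k.+3 + 3)%N -> (forall i, g i \in S) ->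
    \det (\matrix_(i, j) xmonomial x j (g i)) = 0.
  move=> nE; subst n => gS; apply: (@det_xmonomial_eq0 k p y0 C x N L) => //.
  - by move=> i; case: (cS _ (gS i)).
  - by move=> i; case: (cS _ (gS i)).
  - by have -> : (k.+3 + 3 = k + 6)%N by lia.
  - by move=> i; case: (cS _ (gS i)).
have [g gS|P [Q [sP sQ PQ0 rPQ _]]] := bounded_cluster_xrel (leqnn _) cS.
  by apply: det0 gS; lia.
exact: size_cluster_xrel sP sQ PQ0 rPQ.
Qed.

End Cluster.

Local Close Scope ring_scope.

(** * Counting solutions of congruences in a box *)

Lemma sum_bool_count (P : pred nat) a b :
  \sum_(a <= x < b) P x = count P (index_iota a b).
Proof. by rewrite -sum1_count [RHS]big_mkcond; apply: eq_bigr => x _; case: (P x). Qed.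

(** Members of one residue class modulo M are told apart by their quotients by M. *)
Lemma count_congruent (P : pred nat) (M N : nat) : 0 < M ->
  (forall x x', P x -> P x' -> x = x' %[mod M]) ->
  \sum_(1 <= x < N.+1) P x <= (N %/ M).+1.
Proof.
move=> M0 PM; rewrite sum_bool_count -size_filter.
rewrite -(size_map (divn^~ M)) -[leqRHS](size_iota 0).
apply: uniq_leq_size.
  rewrite map_inj_in_uniq ?filter_uniq ?iota_uniq// => x x'.
  rewrite !mem_filter => /andP[Px _] /andP[Px' _] /= xx'.
  by rewrite (divn_eq x M) (divn_eq x' M) xx' (PM _ _ Px Px').
move=> _ /mapP[x + ->]; rewrite mem_filter mem_index_iota => /and3P[_ _ xN].
by rewrite mem_iota /= add0n ltnS leq_div2r.
Qed.

Lemma coprime_prod_primes p (s : seq nat) : prime p -> all prime s ->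
  p \notin s -> coprime p (\prod_(q <- s) q).
Proof.
move=> p_pr s_pr ps; rewrite big_seq.
elim/big_ind: _ => [|m n pm pn|q qs]; first by rewrite coprimen1.
  by rewrite coprimeMr pm.
rewrite prime_coprime// dvdn_prime2//; last exact: (allP s_pr q qs).
by apply: contraNneq ps => ->.
Qed.

(** * Sums of periodic functions *)

Section PeriodicSum.
Variables (F : nat -> nat) (M : nat).
Hypotheses (M_gt0 : 0 < M) (FM : forall x, F (x + M) = F x).

Lemma sum_period a : \sum_(a <= x < a + M) F x = \sum_(0 <= x < M) F x.
Proof.
elim: a => [|a <-]; first by rewrite add0n.
have aM : a < a + M by rewrite -[ltnLHS]addn0 ltn_add2l.
by rewrite addSn (big_nat_recr (a + M))//= FM [RHS]big_ltn// addnC.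
Qed.

Lemma sum_periods a q :
  \sum_(a <= x < a + q * M) F x = q * \sum_(0 <= x < M) F x.
Proof.
elim: q => [|q IH]; first by rewrite addn0 big_geq.
rewrite (mulSnr q M) addnA (big_cat_nat (n := a + q * M)) ?leq_addr//=.
by rewrite IH sum_period mulSnr.
Qed.

Lemma sum_periodic_ge N :
  (N %/ M) * \sum_(0 <= x < M) F x <= \sum_(1 <= x < N.+1) F x.
Proof.
rewrite -(sum_periods 1) [leqRHS](big_cat_nat (n := 1 + N %/ M * M))//=.
  by rewrite leq_addr.
by rewrite add1n ltnS leq_trunc_div.
Qed.

Lemma sum_periodic_le N :
  \sum_(1 <= x < N.+1) F x <= (N %/ M).+1 * \sum_(0 <= x < M) F x.
Proof.
rewrite -(sum_periods 1) [leqRHS](big_cat_nat (n := N.+1))//=.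
  by rewrite leq_addr.
by rewrite add1n ltnS ltnW// ltn_ceil.
Qed.

End PeriodicSum.

Lemma sum_chinese (m n : nat) (F : nat -> nat -> nat) :
  0 < m -> 0 < n -> coprime m n ->
  \sum_(0 <= u < m * n) F (u %% m) (u %% n) =
  \sum_(0 <= a < m) \sum_(0 <= b < n) F a b.
Proof.
move=> m0 n0 mn; rewrite !big_mkord.
under [RHS]eq_bigr do rewrite big_mkord.
rewrite pair_big /=.
pose h (u : 'I_(m * n)) :=
  (Ordinal (ltn_pmod u m0), Ordinal (ltn_pmod u n0)).
rewrite (reindex h) /=; first exact: eq_bigl.
apply: onW_bij; apply: inj_card_bij; last by rewrite card_prod !card_ord.
move=> u v [um un]; apply: val_inj => /=.
have /eqP : u = v %[mod m * n] by apply/eqP; rewrite chinese_remainder// um un !eqxx.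
by rewrite !modn_small// => /eqP.
Qed.

(** * Local counts and the number of solutions in a box *)

Section Divisibility.
Variables (k : nat) (C : int).
Hypotheses (k_gt0 : 0 < k) (C_neq0 : C != 0%R).

Definition fval (x y : nat) : int := (x%:Z * y%:Z ^+ k + C)%R.
Definition dvf (m x y : nat) : bool := (m%:Z %| fval x y)%Z.
Definition rhoN (m : nat) : nat :=
  \sum_(0 <= u < m) \sum_(0 <= v < m) dvf m u v.

Lemma dvf_modl m x y : dvf m (x %% m) y = dvf m x y.
Proof.
have E : (fval (x %% m) y = fval x y %[mod m%:Z])%Z.
  by rewrite /fval -modz_nat -modzDml modzMml modzDml.
by rewrite /dvf; apply/dvdz_mod0P/dvdz_mod0P; rewrite E.
Qed.

Lemma dvf_modr m x y : dvf m x (y %% m) = dvf m x y.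
Proof.
have E : (fval x (y %% m) = fval x y %[mod m%:Z])%Z.
  by rewrite /fval -modz_nat -modzDml -modzMmr modzXm modzMmr modzDml.
by rewrite /dvf; apply/dvdz_mod0P/dvdz_mod0P; rewrite E.
Qed.

Lemma rho_multiplicative m n : 0 < m -> 0 < n -> coprime m n ->
  rhoN (m * n) = rhoN m * rhoN n.
Proof.
move=> m0 n0 mn.
have dvfM u v : (dvf (m * n) u v = dvf m (u %% m) (v %% m) * dvf n (u %% n) (v %% n) :> nat).
  by rewrite !dvf_modl !dvf_modr /dvf !dvdzE /= Gauss_dvd// mulnb.
transitivity (\sum_(0 <= u < m * n) \sum_(0 <= c < m) \sum_(0 <= e < n)
    dvf m (u %% m) c * dvf n (u %% n) e).
  apply: eq_bigr => u _.
  rewrite -(sum_chinese (fun c e => dvf m (u %% m) c * dvf n (u %% n) e))//.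
  by apply: eq_bigr => v _; rewrite dvfM.
rewrite (sum_chinese (fun a b => \sum_(0 <= c < m) \sum_(0 <= e < n)
    dvf m a c * dvf n b e))//.
rewrite /rhoN big_distrl; apply: eq_bigr => a _ /=.
rewrite big_distrr; apply: eq_bigr => b _ /=.
rewrite big_distrl; apply: eq_bigr => c _ /=.
by rewrite big_distrr.
Qed.

Lemma rhoN1 : rhoN 1 = 1.
Proof. by rewrite /rhoN !big_nat1 /dvf dvd1z. Qed.

Lemma rho_prod_primes (s : seq nat) : uniq s -> all prime s ->
  rhoN ((\prod_(p <- s) p) ^ k) = \prod_(p <- s) rhoN (p ^ k).
Proof.
elim: s => [_ _|p s IH /= /andP[ps us] /andP[p_pr s_pr]].
  by rewrite !big_nil exp1n rhoN1.
rewrite !big_cons expnMn rho_multiplicative ?IH//.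
- by rewrite expn_gt0 prime_gt0.
- rewrite expn_gt0; apply/orP; left; rewrite big_seq prodn_cond_gt0// => q.
  by move=> /(allP s_pr); exact: prime_gt0.
- exact/coprimeXl/coprimeXr/coprime_prod_primes.
Qed.

(** If there is a solution, g = gcd(d^k, y^k) divides C, so g <= |C|. Then x is determined modulo
    d^k / g, which is at least d^k / |C|. Moduli sharing factors with C are thus covered
    uniformly. *)
Lemma dvf_count_x d y N : 0 < d ->
  \sum_(1 <= x < N.+1) dvf (d ^ k) x y <= ((N * `|C|) %/ d ^ k).+1.
Proof.
move=> d0; have dk0 : 0 < d ^ k by rewrite expn_gt0 d0.
pose g := gcdn (d ^ k) (y ^ k).
have [gC|gC] := boolP (g%:Z %| C)%Z; last first.
  rewrite big1// => x _; apply/eqP; rewrite eqb0; apply: contraNN gC => dvx.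
  have : (g%:Z %| fval x y)%Z.
    by apply: dvdz_trans dvx; rewrite dvdzE /= dvdn_gcdl.
  rewrite /fval rpredDl// dvdz_mull// -[Posz y]natz -natrX natz dvdzE /=.
  exact: dvdn_gcdr.
have g0 : 0 < g by rewrite gcdn_gt0 dk0.
have gC' : g <= `|C| by rewrite dvdn_leq ?absz_gt0.
have gd : g %| d ^ k by exact: dvdn_gcdl.
apply: (@leq_trans (N %/ (d ^ k %/ g)).+1); last first.
  rewrite ltnS -(divnMr g0) divnK// leq_div2r// leq_mul2l gC' orbT//.
apply: count_congruent; first by rewrite divn_gt0// dvdn_leq.
move=> x x' dx dx'; apply/eqP; wlog xx' : x x' dx dx' / x' <= x.
  by move=> h; case/orP: (leq_total x' x) => /h; [|rewrite eq_sym]; apply.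
rewrite eqn_mod_dvd//.
have : (d ^ k %| (x - x') * y ^ k).
  have : ((d ^ k)%N%:Z %| (fval x y - fval x' y)%R)%Z by rewrite rpredB.
  rewrite /fval opprD addrACA subrr addr0 -mulrBl subzn// -[Posz y]natz -natrX natz.
  by rewrite -PoszM.
move=> dxy; rewrite -(dvdn_pmul2r g0) divnK// /g muln_gcdr dvdn_gcd dxy andbT.
exact: dvdn_mull.
Qed.

(** Case N = d^k of [dvf_count_x]: each v admits at most |C| + 1 <= 2 |C| values of u. *)
Lemma rho_pow_le d : 0 < d -> rhoN (d ^ k) <= 2 * `|C| * d ^ k.
Proof.
move=> d0; have dk0 : 0 < d ^ k by rewrite expn_gt0 d0.
rewrite /rhoN exchange_big /=.
apply: (@leq_trans (\sum_(0 <= v < d ^ k) (2 * `|C|))); last first.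
  by rewrite sum_nat_const_nat subn0 mulnC.
apply: leq_sum => v _.
rewrite -(@sum_period (fun u => nat_of_bool (dvf (d ^ k) u v)) _ dk0 _ 1).
  by rewrite add1n (leq_trans (dvf_count_x _ _ d0))// mulKn//; lia.
by move=> u; rewrite -dvf_modl modnDr dvf_modl.
Qed.

Definition box_count (N m : nat) : nat :=
  \sum_(1 <= x < N.+1) \sum_(1 <= y < N.+1) dvf m x y.

Lemma box_count_le N d : 0 < d ->
  box_count N (d ^ k) <= N * ((N * `|C|) %/ d ^ k).+1.
Proof.
move=> d0; rewrite /box_count exchange_big /=.
apply: leq_trans (_ : \sum_(1 <= y < N.+1) ((N * `|C|) %/ d ^ k).+1 <= _).
  by apply: leq_sum => y _; exact: dvf_count_x.
by rewrite sum_nat_const_nat subn1.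
Qed.

Lemma box_count_bounds N m : 0 < m ->
  (N %/ m) ^ 2 * rhoN m <= box_count N m <= (N %/ m).+1 ^ 2 * rhoN m.
Proof.
move=> m0; pose G x := \sum_(0 <= v < m) dvf m x v.
have GM x : G (x + m) = G x.
  by apply: eq_bigr => v _; rewrite -dvf_modl modnDr dvf_modl.
have FM x y : nat_of_bool (dvf m x (y + m)) = dvf m x y.
  by rewrite -dvf_modr modnDr dvf_modr.
apply/andP; split.
  rewrite -mulnn -mulnA; apply: leq_trans (_ : (N %/ m) * \sum_(1 <= x < N.+1) G x <= _).
    by rewrite leq_mul2l; apply/orP; right; exact: (sum_periodic_ge m0 GM).
  rewrite big_distrr; apply: leq_sum => x _; exact: (sum_periodic_ge m0 (FM x)).
rewrite -mulnn -mulnA; apply: leq_trans (_ : _ <= (N %/ m).+1 * \sum_(1 <= x < N.+1) G x) _.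
  rewrite big_distrr; apply: leq_sum => x _; exact: (sum_periodic_le m0 (FM x)).
by rewrite leq_mul2l; apply/orP; right; exact: (sum_periodic_le m0 GM).
Qed.

End Divisibility.

(** * Large prime moduli *)

Lemma count_unique (P : pred nat) (N : nat) :
  (forall x x', 1 <= x <= N -> 1 <= x' <= N -> P x -> P x' -> x = x') ->
  \sum_(1 <= x < N.+1) P x <= 1.
Proof.
move=> PU; pose P' x := (1 <= x <= N) && P x.
rewrite (@eq_big_nat _ _ _ _ _ _ (fun x => nat_of_bool (P' x))).
  rewrite (leq_trans (@count_congruent P' N.+1 N _ _))// ?divn_small//.
  by move=> x x' /andP[h1 h2] /andP[h3 h4]; rewrite (PU x x').
by move=> x xN; rewrite /P' -ltnS xN.
Qed.

(** For m < n, n^(k+1) = n^k + (n - 1) n^k >= n^k + m^(k+1). *)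
Lemma expn_gap k a b : a != b -> a ^ k <= absz ((a ^ k.+1)%N%:Z - (b ^ k.+1)%N%:Z)%R.
Proof.
have gap m n : m < n -> n ^ k + m ^ k.+1 <= n ^ k.+1.
  move=> mn; rewrite !expnS -[X in _ <= X * _](prednK (leq_ltn_trans (leq0n _) mn)).
  rewrite mulSn leq_add2l leq_mul//; first by rewrite -ltnS prednK// (leq_ltn_trans _ mn).
  by rewrite leq_expn// ltnW.
rewrite neq_ltn => /orP[ab|ba].
  have := gap _ _ ab; have := leq_expn k (ltnW ab); lia.
by have := gap _ _ ba; lia.
Qed.

Section LargePrimes.
Variables (k : nat) (C : int) (N : nat).
Hypotheses (k_gt1 : 1 < k) (C_neq0 : C != 0%R).

(** Zeros of f are divisible by every p^k and correspond to m = 0 in f = m p^k, so they are removed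
    before large p are treated. For each y >= 1 at most one x gives a zero. *)
Lemma sum_fval_eq0 :
  \sum_(1 <= x < N.+1) \sum_(1 <= y < N.+1) (fval k C x y == 0%R) <= N.
Proof.
rewrite exchange_big /=.
apply: leq_trans (_ : \sum_(1 <= y < N.+1) 1 <= _); last by rewrite sum_nat_const_nat subn1 muln1.
rewrite big_nat [leqRHS]big_nat; apply: leq_sum => y /andP[y0 _]; apply: count_unique => x x' _ _.
rewrite /fval => /eqP fx; rewrite -fx => /eqP/addIr/eqP; rewrite -subr_eq0 -mulrBl.
rewrite mulf_eq0 expf_eq0 => /orP[|/andP[_]]; last by rewrite -[0%R]/(Posz 0) eqz_nat; lia.
by rewrite subr_eq0 eqz_nat => /eqP.
Qed.

(** Suppose y' < y. If p' y = p y', the identity forces y^k = y'^k. Otherwise its left side is at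
    least (p' y)^(k-1) by [expn_gap] and its right side at most |C| y^k, so p'^(k-1) <= |C| y <= |C|
    N < p', which is impossible for k >= 2. *)
Lemma large_prime_unique (x p p' y y' : nat) (m : int) :
  `|C| * N < p -> `|C| * N < p' -> 1 <= y <= N -> 1 <= y' <= N -> m != 0%R ->
  fval k C x y = (m * p%:Z ^+ k)%R -> fval k C x y' = (m * p'%:Z ^+ k)%R -> y = y'.
Proof.
wlog yy' : p p' y y' / y' < y.
  move=> h pC p'C yN y'N m0 fy fy'; case: (ltngtP y y') => // yy'.
    by rewrite (h p' p y' y).
  by rewrite (h p p' y y').
move=> pC p'C /andP[y0 yN] /andP[y'0 y'N] m0 fy fy'.
have key : (m * ((p' * y)%N%:Z ^+ k - (p * y')%N%:Z ^+ k) =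
            C * (y%:Z ^+ k - y'%:Z ^+ k))%R.
  rewrite !PoszM !exprMn mulrBr !mulrA -fy -fy' /fval; ring.
have k0 : 0 < k by exact: ltnW.
have ykk : y' ^ k < y ^ k by rewrite ltn_exp2r.
have E (n : nat) : (n%:Z ^+ k)%R = Posz (n ^ k.-1.+1).
  by rewrite prednK// -[Posz n]natz -natrX natz.
have neq : p' * y != p * y'.
  apply/eqP => e; move: key; rewrite e subrr mulr0 => /esym/eqP.
  rewrite mulf_eq0 (negbTE C_neq0) /= !E subr_eq0 eqz_nat prednK// => /eqP; lia.
have := expn_gap k.-1 neq; rewrite -!E => gap.
have : (p' * y) ^ k.-1 <= `|C| * y ^ k.
  apply: leq_trans gap _.
  apply: leq_trans (_ : absz (m * ((p' * y)%N%:Z ^+ k - (p * y')%N%:Z ^+ k))%R <= _).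
    by rewrite abszM leq_pmull// absz_gt0.
  by rewrite key abszM leq_mul// !E prednK//; lia.
rewrite -[X in _ <= _ * _ ^ X](prednK k0) expnS mulnA expnMn leq_pmul2r ?expn_gt0 ?y0//.
have : p' <= p' ^ k.-1 by rewrite -[X in X <= _]expn1 leq_pexp2l; lia.
have : `|C| * y <= `|C| * N by rewrite leq_mul2l yN orbT.
lia.
Qed.

(** The second hypothesis forces |m| <= M in f = m p^k; each x and each of the 2 M nonzero values of
    m leave at most one y. *)
Lemma sum_large_primes_le (B M : nat) :
  `|C| * N <= B -> (N ^ k.+1 + `|C| <= M * B ^ k) ->
  \sum_(1 <= x < N.+1) \sum_(1 <= y < N.+1)
    `[< fval k C x y != 0%R /\ exists2 p, B < p & dvf k C (p ^ k) x y >]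
  <= N * (M * 2).
Proof.
move=> CB MB.
pose Q x (m : int) y := `[< exists2 p, B < p & fval k C x y = (m * p%:Z ^+ k)%R >].
have Q1 x m : m != 0%R -> \sum_(1 <= y < N.+1) Q x m y <= 1.
  move=> m0; apply: count_unique => y y' yN y'N /asboolP[p Bp fy] /asboolP[p' Bp' fy'].
  by apply: large_prime_unique fy fy' => //; exact: leq_ltn_trans CB _.
apply: leq_trans (_ : \sum_(1 <= x < N.+1) (M * 2) <= _); last first.
  by rewrite sum_nat_const_nat subn1.
rewrite big_nat [leqRHS]big_nat; apply: leq_sum => x /andP[x0 xN].
apply: leq_trans (_ : \sum_(1 <= y < N.+1) \sum_(1 <= m < M.+1)
    (Q x (Posz m) y + Q x (- m%:Z)%R y) <= _).
  rewrite big_nat [leqRHS]big_nat; apply: leq_sum => y /andP[y0 yN].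
  case: asboolP => //= -[f0 [p Bp]] /dvdzP[m fm].
  have pk0 : 0 < p ^ k by rewrite expn_gt0 (leq_ltn_trans _ Bp).
  have m0 : m != 0%R by apply: contraNneq f0 => m0; rewrite fm m0 mul0r.
  have mM : `|m| <= M.
    have [B0|B0] := posnP B.
      by move: MB CB x0 xN; rewrite B0 exp0n ?muln0; have := C_neq0; lia.
    rewrite -(@leq_pmul2r (B ^ k)) ?expn_gt0 ?B0//; apply: leq_trans MB.
    apply: leq_trans (_ : `|fval k C x y| <= _).
      by rewrite fm abszM leq_mul2l /= leq_expn ?orbT// ltnW.
    have absD (a b : int) : absz (a + b)%R <= `|a| + `|b| by lia.
    apply: leq_trans (absD _ _) _; rewrite leq_add2r abszM abszX expnS.
    by rewrite leq_mul// ?leq_expn.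
  have m1 : 1 <= `|m| < M.+1 by rewrite absz_gt0 m0.
  rewrite (bigD1_seq `|m|%N) ?iota_uniq ?mem_index_iota//=.
  have : 0 < Q x (Posz `|m|) y + Q x (- Posz `|m|)%R y.
    rewrite addn_gt0 !lt0b; apply/orP; have [m_ge0|m_lt0] := leP 0%R m.
      by left; apply/asboolP; exists p; rewrite // gez0_abs// fm -[Posz p]natz -natrX natz.
    right; apply/asboolP; exists p; rewrite // ltz0_abs// opprK fm.
    by rewrite -[Posz p]natz -natrX natz.
  by move=> /leq_trans; apply; exact: leq_addr.
rewrite exchange_big /=.
apply: leq_trans (_ : \sum_(1 <= m < M.+1) 2 <= _); last first.
  by rewrite sum_nat_const_nat subn1.
rewrite big_nat [leqRHS]big_nat; apply: leq_sum => m /andP[m0 _].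
by rewrite big_split (leq_add (Q1 _ _ _) (Q1 _ _ _))// ?oppr_eq0 eqz_nat -lt0n.
Qed.

End LargePrimes.

(** * Primes in the critical range *)

Section CriticalPrimes.
Variables (k : nat) (C : int) (N L Delta : nat).
Hypotheses (k_gt0 : 0 < k) (L_gt0 : 0 < L) (N_gt0 : 0 < N).

Let Z := (k + 6)`! * (L ^ k.+2 * N) ^ (k + 6).
Hypothesis DeltaP : forall n, 0 < n ->
  n <= (k + 4)`! * Z ^ (k + 4) -> size (divisors n) <= Delta.

Definition cluster_bound := Delta * (2 * k.+2) + k.+3 + k.+2 * k.+2.

(** Since p does not divide C, a solution has y prime to p, so x is determined modulo p^k > N. The
    solutions in a window therefore form the graph of a function of u, as [size_cluster]
    requires. *)
Lemma sum_window_le (p y0 : nat) :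
  prime p -> ~~ (Posz p %| C)%Z -> L <= p -> N < p ^ k ->
  (k + 6)`! * (L ^ (k.+2 * (k + 6)) * N ^ k.+3) < p ^ (3 * k) ->
  \sum_(0 <= u < L) \sum_(1 <= x < N.+1) dvf k C (p ^ k) x (y0 + u)
    <= cluster_bound.
Proof.
move=> p_pr pC Lp Npk Hp.
pose xs u := [seq x <- index_iota 1 N.+1 | dvf k C (p ^ k) x (y0 + u)].
pose S := [seq u <- iota 0 L | xs u != [::]].
apply: leq_trans (_ : size S <= _); last first.
  (* The default 0 of [head] is never met on [S], where [xs u] is nonempty. *)
  apply: (@size_cluster k p y0 N L Delta C (fun u => head 0 (xs u))) => //.
    by rewrite filter_uniq ?iota_uniq.
  move=> u; rewrite mem_filter mem_iota add0n => /andP[xu /= uL].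
  have : head 0 (xs u) \in xs u by case: (xs u) xu => //= x s _; rewrite mem_head.
  by rewrite mem_filter mem_index_iota => /and3P[dx _ xN].
have -> : size S = \sum_(0 <= u < L) (xs u != [::]).
  by rewrite (sum_bool_count (fun u => xs u != [::])) /index_iota subn0 size_filter.
apply: leq_sum => u _.
have [xu|xu] := eqVneq (xs u) [::].
  by rewrite sum_bool_count -size_filter -/(xs u) xu.
apply: count_unique => x x' /andP[x1 xN] /andP[x'1 x'N] dx dx'.
wlog xx' : x x' x1 xN x'1 x'N dx dx' / x' <= x.
  move=> h; case/orP: (leq_total x' x) => xx'; first exact: h.
  by apply/esym; exact: h.
have pdvd : (p %| p ^ k) by exact: dvdn_exp.
have py : coprime (p ^ k) ((y0 + u) ^ k).
  rewrite coprimeXl// coprimeXr// prime_coprime//.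
  apply: contra pC => py.
  have : (Posz p %| fval k C x (y0 + u))%Z.
    by apply: dvdz_trans dx; rewrite dvdzE.
  rewrite /fval rpredDl// dvdz_mull// -[Posz (y0 + u)]natz -natrX natz dvdzE /=.
  exact: dvdn_exp.
have : (p ^ k %| (x - x') * (y0 + u) ^ k).
  have : (Posz (p ^ k) %| (fval k C x (y0 + u) - fval k C x' (y0 + u))%R)%Z.
    by rewrite rpredB.
  rewrite /fval opprD addrACA subrr addr0 -mulrBl subzn// -[Posz (y0 + u)]natz.
  by rewrite -natrX natz -PoszM.
rewrite Gauss_dvdl// => dvx; apply/eqP; rewrite eqn_leq xx' andbT -subn_eq0.
by apply: contraLR dvx; rewrite -lt0n => h; rewrite gtnNdvd//; lia.
Qed.

Lemma sum_windows_le (G : nat -> nat) (F q : nat) :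
  (forall j, \sum_(0 <= u < L) G (j * L + u) <= F) ->
  \sum_(0 <= y < q * L) G y <= q * F.
Proof.
move=> GF; elim: q => [|q IH]; first by rewrite big_geq.
rewrite (big_cat_nat (n := q * L))//=; last by rewrite leq_mul2r leqnSn orbT.
rewrite [q.+1 * F]mulSnr leq_add// -{1}[q * L]add0n big_addn mulSn addnK.
by rewrite (eq_bigr (fun u => G (q * L + u)))// => u _; rewrite addnC.
Qed.

Lemma sum_critical_prime_le (p : nat) :
  prime p -> ~~ (Posz p %| C)%Z -> L <= p -> N < p ^ k ->
  (k + 6)`! * (L ^ (k.+2 * (k + 6)) * N ^ k.+3) < p ^ (3 * k) ->
  box_count k C N (p ^ k) <= (N %/ L).+1 * cluster_bound.
Proof.
move=> p_pr pC Lp Npk Hp; rewrite /box_count exchange_big /=.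
pose G y := \sum_(1 <= x < N.+1) dvf k C (p ^ k) x y.
apply: leq_trans (_ : \sum_(0 <= y < (N %/ L).+1 * L) G y <= _).
  rewrite [leqRHS](big_cat_nat (n := 1))//=; last by rewrite muln_gt0.
  rewrite (leq_trans _ (leq_addl _ _))//.
  rewrite [leqRHS](big_cat_nat (n := N.+1))//=; first by rewrite leq_addr.
  by rewrite ltn_ceil.
by apply: sum_windows_le => j; exact: sum_window_le.
Qed.

End CriticalPrimes.

Local Open Scope ring_scope.

(** * Sieve by small primes *)

Section Sieve.
Variable (R : realFieldType).

(** A squarefree d with prime factors at most t is encoded by its set S of prime factors, so that
    mu(d) is (-1)^|S|. *)
Definition setprod n (S : {set 'I_n}) : nat := (\prod_(i in S) i)%N.

Lemma setprodE n (S : {set 'I_n}) :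
  setprod S = (\prod_(p <- [seq val i | i <- enum S]) p)%N.
Proof. by rewrite big_map big_enum. Qed.

(* For any q in T, the terms of S and q |: S cancel unless
   setprod S <= D < q * setprod S. *)
Lemma truncated_mobius n (D t : nat) (T : {set 'I_n}) : (0 < D)%N ->
  (forall i, i \in T -> (0 < i <= t)%N) ->
  `|(T == set0)%:R - \sum_(S : {set 'I_n} | (S \subset T) && (setprod S <= D)%N)
       (-1) ^+ #|S| : R|
  <= \sum_(S : {set 'I_n} | (S \subset T) && (D < t * setprod S)%N
        && (setprod S <= D)%N) 1.
Proof.
move=> D0 Tt; have [T0|[q qT]] := set_0Vmem T.
  rewrite T0 eqxx (bigD1 set0) /=; last first.
    by rewrite sub0set /setprod big_set0.
  rewrite cards0 big1; last by move=> S; rewrite subset0 => /andP[/andP[->]].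
  by rewrite addr0 subrr normr0 sumr_ge0.
have /negbTE -> : T != set0 by apply/set0Pn; exists q.
rewrite sub0r normrN.
rewrite (bigID (fun S : {set 'I_n} => q \in S)) /=.
rewrite (reindex_onto (fun S => q |: S) (fun S => S :\ q)) /=; last first.
  by move=> S /andP[_ qS]; rewrite setD1K.
rewrite (eq_bigl (fun S : {set 'I_n} => (q \notin S) && (S \subset T) &&
    (q * setprod S <= D)%N)); last first.
  move=> S; rewrite setU11 andbT subUset sub1set qT /=.
  have [qS|qS] /= := boolP (q \in S).
    rewrite andbC; apply/negbTE; apply/negP => /andP[/eqP h _].
    by move: qS; rewrite -h !inE eqxx.
  rewrite setU1K// eqxx andbT /setprod big_setU1//.
rewrite (eq_bigr (fun S : {set 'I_n} => - (-1) ^+ #|S|)); last first.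
  by move=> S /andP[/andP[qS _] _]; rewrite cardsU1 qS exprS mulN1r.
rewrite [X in X + _]big_mkcond [X in _ + X]big_mkcond -big_split /=.
rewrite [leRHS]big_mkcond (le_trans (ler_norm_sum _ _ _))//.
apply: ler_sum => S _.
have [/andP[q0 qt]] := (Tt q qT).
have [ST|] := boolP (S \subset T); rewrite /= ?andbF ?addr0 ?normr0//.
have [qS|qS] := boolP (q \in S); rewrite /= ?andbF ?andbT ?addr0 ?add0r ?normr0//.
  by case: ifP.
have [dD|dD] := leqP (setprod S) D; rewrite /= ?andbF ?andbT.
  have [qd|qd] := leqP (q * setprod S) D; first by rewrite addNr normr0; case: ifP.
  by rewrite add0r normrX normrN1 expr1n ifT// (leq_trans qd)// leq_mul2r qt orbT.
rewrite ifF ?addr0 ?normr0//; apply/negbTE; rewrite -ltnNge (leq_trans dD)//.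
by rewrite leq_pmull.
Qed.

(** Telescoping, from 1/d^k <= 1/d^2 <= 1/(d - 1) - 1/d. *)
Lemma sum_inv_pow_le (k t X : nat) : (1 < k)%N -> (0 < t)%N ->
  \sum_(t.+1 <= d < X) ((d ^ k)%N%:R)^-1 <= (t%:R)^-1 :> R.
Proof.
move=> k1 t0.
have [tX|tX] := leqP X t; first by rewrite big_geq ?invr_ge0// ltnW.
suff : \sum_(t.+1 <= d < X) ((d ^ k)%N%:R)^-1 <= (t%:R)^-1 - (X.-1%:R)^-1 :> R.
  by move=> /le_trans; apply; rewrite gerBl invr_ge0.
elim: X tX => // X IH; rewrite ltnS leq_eqVlt => /orP[/eqP <-|tX].
  by rewrite big_geq// subrr.
rewrite big_nat_recr//= (le_trans (lerD (IH tX) (lexx _)))//.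
suff : ((X ^ k)%N%:R)^-1 <= (X.-1%:R)^-1 - (X%:R)^-1 :> R by lra.
have X1 : (0 < X.-1)%N by lia.
have XE : X = X.-1.+1 by lia.
have : ((X ^ k)%N%:R)^-1 <= ((X ^ 2)%N%:R)^-1 :> R.
  have X0 : (0 < X)%N by rewrite XE.
  by rewrite lef_pV2 ?posrE ?ltr0n ?expn_gt0 ?X0// ler_nat leq_pexp2l.
move=> /le_trans; apply.
have a0 : (0 : R) < X.-1%:R by rewrite ltr0n.
rewrite XE /= natrX -natr1; move: (X.-1%:R : R) a0 => a a0.
rewrite -subr_ge0.
have -> : a^-1 - (a + 1)^-1 - (a + 1) ^- 2 = a^-1 * (a + 1) ^- 2.
  by field; apply/andP; split; lra.
by rewrite mulr_ge0// invr_ge0 ?exprn_ge0; lra.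
Qed.

End Sieve.

Lemma ler_sum_sub (R : realFieldType) (T : eqType) (s r : seq T) (F : T -> R) :
  uniq s -> uniq r -> {subset s <= r} -> (forall x, 0 <= F x) ->
  \sum_(x <- s) F x <= \sum_(x <- r) F x.
Proof.
move=> us ur sr F0.
have ps : perm_eq s [seq x <- r | x \in s].
  apply: uniq_perm; rewrite ?filter_uniq// => x; rewrite mem_filter.
  by case: (boolP (x \in s)) => //= /sr ->.
rewrite (perm_big _ ps) big_filter big_mkcond.
by apply: ler_sum => x _; case: ifP.
Qed.

Lemma dvdn_prod_primes_pow (k : nat) (s : seq nat) (n : nat) :
  uniq s -> all prime s ->
  ((\prod_(p <- s) p) ^ k %| n)%N = all (fun p => (p ^ k %| n)%N) s.
Proof.
elim: s => [_ _|p s IH /= /andP[ps us] /andP[p_pr s_pr]].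
  by rewrite big_nil exp1n dvd1n.
rewrite big_cons expnMn Gauss_dvd ?IH//.
exact/coprimeXl/coprimeXr/coprime_prod_primes.
Qed.

(** * The truncated sieve over the box *)

Section SieveCount.
Variables (R : realFieldType) (k : nat) (C : int) (N t : nat).
Hypotheses (k_gt1 : (1 < k)%N) (C_neq0 : C != 0) (t_gt0 : (0 < t)%N).

Let k_gt0 : (0 < k)%N := ltnW k_gt1.

Definition primeset : {set 'I_t.+1} := [set i : 'I_t.+1 | prime i].

Definition powdivs x y : {set 'I_t.+1} :=
  [set i in primeset | dvf k C (i ^ k)%N x y].

Lemma primes_enum (S : {set 'I_t.+1}) : S \subset primeset ->
  uniq [seq val i | i <- enum S] /\ all prime [seq val i | i <- enum S].
Proof.
move=> SP; split; first by rewrite (map_inj_uniq val_inj) enum_uniq.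
by apply/allP => _ /mapP[i + ->]; rewrite mem_enum => /(subsetP SP); rewrite inE.
Qed.

Lemma setprod_gt0 (S : {set 'I_t.+1}) : S \subset primeset -> (0 < setprod S)%N.
Proof.
move=> SP; apply: prodn_cond_gt0 => i /(subsetP SP); rewrite inE.
exact: prime_gt0.
Qed.

Lemma dvf_setprod x y (S : {set 'I_t.+1}) : S \subset primeset ->
  dvf k C (setprod S ^ k)%N x y = (S \subset powdivs x y).
Proof.
move=> SP; have [uS pS] := primes_enum SP.
rewrite /dvf dvdzE /= setprodE dvdn_prod_primes_pow//.
apply/allP/subsetP => [h i iS|h _ /mapP[i + ->]].
  by rewrite inE (subsetP SP i iS) /dvf dvdzE h// map_f// mem_enum.
by rewrite mem_enum => /h; rewrite inE /dvf dvdzE => /andP[].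
Qed.

Lemma setprod_inj (S S' : {set 'I_t.+1}) : S \subset primeset ->
  S' \subset primeset -> setprod S = setprod S' -> S = S'.
Proof.
have half (A B : {set 'I_t.+1}) : A \subset primeset -> B \subset primeset ->
    setprod A = setprod B -> A \subset B.
  move=> AP BP AB; apply/subsetP => i iA.
  have := subsetP AP i iA; rewrite inE => i_pr.
  have : (i %| setprod B)%N by rewrite -AB /setprod (bigD1 i)//= dvdn_mulr.
  rewrite Euclid_dvd_prod// big_orE => /existsP[j /andP[jB]].
  have := subsetP BP j jB; rewrite inE => j_pr.
  by rewrite dvdn_prime2// => /eqP/val_inj ->.
by move=> SP SP' SS; apply/eqP; rewrite eqEsubset (half S S')// (half S' S).
Qed.

(** By [setprod_inj], a sum over sets of primes is part of a sum over integers, where elementary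
    tail bounds apply. *)
Lemma sum_setprod_le (P : pred nat) (F : nat -> R) a b :
  (forall d, 0 <= F d) ->
  (forall S : {set 'I_t.+1}, S \subset primeset -> P (setprod S) ->
     (a <= setprod S < b)%N) ->
  \sum_(S : {set 'I_t.+1} | (S \subset primeset) && P (setprod S)) F (setprod S)
  <= \sum_(a <= d < b) F d.
Proof.
move=> F0 Pab; pose Q := [pred S : {set 'I_t.+1} | (S \subset primeset) && P (setprod S)].
have -> : \sum_(S | Q S) F (setprod S) = \sum_(d <- [seq setprod A | A <- enum Q]) F d.
  by rewrite big_map big_enum.
apply: ler_sum_sub => //; rewrite ?iota_uniq//.
  rewrite map_inj_in_uniq ?enum_uniq// => S S'; rewrite !mem_enum !inE.
  by move=> /andP[SP _] /andP[SP' _]; exact: setprod_inj.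
move=> _ /mapP[S + ->]; rewrite mem_enum inE mem_index_iota => /andP[]; exact: Pab.
Qed.

Definition sieve_count : nat :=
  (\sum_(1 <= x < N.+1) \sum_(1 <= y < N.+1) (powdivs x y == set0))%N.

(** Serves twice: for the truncation error, with X = t^2, and for the moduli between t and
    t^(w-1). *)
Lemma sum_box_counts_le X :
  \sum_(t.+1 <= d < X.+1) (box_count k C N (d ^ k))%:R <=
  N%:R ^+ 2 * `|C|%N%:R / t%:R + N%:R * X%:R :> R.
Proof.
apply: (@le_trans _ _ (\sum_(t.+1 <= d < X.+1)
    (N%:R ^+ 2 * `|C|%N%:R * ((d ^ k)%N%:R)^-1 + N%:R))).
  rewrite big_nat [leRHS]big_nat; apply: ler_sum => d /andP[td _].
  have d0 : (0 < d)%N by exact: leq_trans td.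
  have dk0 : (0 : R) < (d ^ k)%N%:R by rewrite ltr0n expn_gt0 d0.
  have := box_count_le k C_neq0 N d0; rewrite -(ler_nat R) => /le_trans; apply.
  rewrite natrM -natr1 mulrDr mulr1 lerD2r expr2 -!mulrA ler_wpM2l ?ler0n//.
  rewrite mulrA -natrM ler_pdivlMr// -natrM ler_nat.
  exact: leq_trunc_div.
rewrite big_split /= -mulr_sumr lerD//.
  by rewrite ler_wpM2l ?mulr_ge0 ?exprn_ge0 ?ler0n// sum_inv_pow_le.
rewrite sumr_const_nat -[_ *+ _]mulr_natr ler_wpM2l ?ler0n// ler_nat.
by rewrite subSS leq_subr.
Qed.

(** At each (x, y), [truncated_mobius] is applied to [powdivs x y] with D = t^2. The discrepancy is
    carried by squarefree d with t < d <= t^2. Truncating keeps the moduli d^k below t^(2k), where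
    box counts are well approximated. *)
Lemma sieve_count_approx :
  `|sieve_count%:R - \sum_(S : {set 'I_t.+1} | (S \subset primeset) &&
       (setprod S <= t ^ 2)%N) (-1) ^+ #|S| * (box_count k C N (setprod S ^ k))%:R|
  <= N%:R ^+ 2 * `|C|%N%:R / t%:R + N%:R * (t ^ 2)%N%:R :> R.
Proof.
pose Q (S : {set 'I_t.+1}) := (S \subset primeset) && (t ^ 2 < t * setprod S)%N
  && (setprod S <= t ^ 2)%N.
apply: (@le_trans _ _ (\sum_(S : {set 'I_t.+1} | Q S)
    (box_count k C N (setprod S ^ k))%:R)); last first.
  apply: le_trans (sum_box_counts_le _).
  rewrite (eq_bigl (fun S : {set 'I_t.+1} => (S \subset primeset) &&
    [pred d | (t ^ 2 < t * d)%N && (d <= t ^ 2)%N] (setprod S))) => [|S]; last first.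
    by rewrite /Q -andbA.
  apply: sum_setprod_le => [d|S SP /andP[]]; first exact: ler0n.
  by rewrite -mulnn ltn_pmul2l// ltnS => -> ->.
have boxE d : (box_count k C N (d ^ k))%:R =
    \sum_(1 <= x < N.+1) \sum_(1 <= y < N.+1) (dvf k C (d ^ k) x y)%:R :> R.
  by rewrite /box_count natr_sum; apply: eq_bigr => x _; rewrite natr_sum.
have -> : \sum_(S : {set 'I_t.+1} | Q S) (box_count k C N (setprod S ^ k))%:R =
    \sum_(1 <= x < N.+1) \sum_(1 <= y < N.+1) \sum_(S : {set 'I_t.+1} | Q S)
       (dvf k C (setprod S ^ k) x y)%:R :> R.
  under eq_bigr do rewrite boxE.
  by rewrite exchange_big; apply: eq_bigr => x _; rewrite exchange_big.
have -> : \sum_(S : {set 'I_t.+1} | (S \subset primeset) && (setprod S <= t ^ 2)%N)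
      (-1) ^+ #|S| * (box_count k C N (setprod S ^ k))%:R =
    \sum_(1 <= x < N.+1) \sum_(1 <= y < N.+1)
      \sum_(S : {set 'I_t.+1} | (S \subset primeset) && (setprod S <= t ^ 2)%N)
       (-1) ^+ #|S| * (dvf k C (setprod S ^ k) x y)%:R :> R.
  under eq_bigr do rewrite boxE mulr_sumr.
  rewrite exchange_big; apply: eq_bigr => x _.
  by under eq_bigr do rewrite mulr_sumr; rewrite exchange_big.
rewrite /sieve_count natr_sum -sumrB (le_trans (ler_norm_sum _ _ _))//.
apply: ler_sum => x _; rewrite natr_sum -sumrB (le_trans (ler_norm_sum _ _ _))//.
apply: ler_sum => y _.
have powdivsP (S : {set 'I_t.+1}) :
    (S \subset primeset) && (S \subset powdivs x y) = (S \subset powdivs x y).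
  apply: andb_idl => /subset_trans; apply; apply/subsetP => i.
  by rewrite inE => /andP[].
have Tt i : i \in powdivs x y -> (0 < i <= t)%N.
  rewrite !inE => /andP[/prime_gt0 -> _] /=.
  by have := ltn_ord i.
have t20 : (0 < t ^ 2)%N by rewrite expn_gt0 t_gt0.
apply: le_trans (le_trans _ (truncated_mobius R t20 Tt)) _.
  rewrite le_eqVlt; apply/orP; left; apply/eqP; congr (`|_ - _|).
  rewrite big_mkcond [RHS]big_mkcond; apply: eq_bigr => S _.
  rewrite -(powdivsP S); have [SP|//] := boolP (S \subset primeset).
  by rewrite dvf_setprod//=; case: (_ <= _)%N; case: (_ \subset _); rewrite ?mulr1 ?mulr0.
rewrite le_eqVlt; apply/orP; left; apply/eqP.
rewrite big_mkcond [RHS]big_mkcond; apply: eq_bigr => S _; rewrite /Q.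
rewrite -(powdivsP S); have [SP|//] := boolP (S \subset primeset).
rewrite dvf_setprod//=; case: (_ \subset _) => //=.
by rewrite if_same.
Qed.

End SieveCount.

(** * Main term *)

Section MainTerm.
Variables (R : realFieldType) (k : nat) (C : int).
Hypotheses (k_gt1 : (1 < k)%N) (C_neq0 : C != 0).

Let k_gt0 : (0 < k)%N := ltnW k_gt1.
Let c : R := `|C|%N%:R.
Let c_ge0 : 0 <= c. Proof. exact: ler0n. Qed.

Definition density (d : nat) : R :=
  (rhoN k C (d ^ k))%:R / (d ^ (2 * k))%N%:R.

Definition euler_factors (n : nat) : R := \prod_(p < n | prime p) (1 - density p).

Lemma density_ge0 d : 0 <= density d.
Proof. by rewrite mulr_ge0 ?invr_ge0 ?ler0n. Qed.

Lemma density_le d : (0 < d)%N -> density d <= 2 * c * ((d ^ k)%N%:R)^-1.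
Proof.
move=> d0; have dk0 : (0 : R) < (d ^ k)%N%:R by rewrite ltr0n expn_gt0 d0.
rewrite /density mul2n -addnn expnD natrM invfM mulrA ler_wpM2r ?invr_ge0 ?ler0n//.
by rewrite ler_pdivrMr// /c -!natrM ler_nat rho_pow_le.
Qed.

Lemma density_le1 d : (0 < d)%N -> density d <= 1.
Proof.
move=> d0; rewrite /density ler_pdivrMr ?ltr0n ?expn_gt0 ?d0// mul1r ler_nat.
rewrite /rhoN; apply: leq_trans (_ : (\sum_(0 <= u < d ^ k) \sum_(0 <= v < d ^ k) 1 <= _)%N).
  by apply: leq_sum => u _; apply: leq_sum => v _; case: (dvf _ _ _ _ _).
by rewrite !sum_nat_const_nat !subn0 muln1 -expnD addnn -mul2n.
Qed.

(** With m = d^k and q the integer part of N/m, the count and N^2 rho / m^2 both lie between q^2 rho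
    and (q + 1)^2 rho. These differ by (2 q + 1) rho, and rho <= 2 c m. *)
Lemma box_count_approx N d : (0 < d)%N ->
  `|(box_count k C N (d ^ k))%:R - N%:R ^+ 2 * density d|
  <= 2 * c * (2 * N%:R + (d ^ k)%N%:R).
Proof.
move=> d0; set m := (d ^ k)%N; have m0 : (0 < m)%N by rewrite expn_gt0 d0.
have m0' : (0 : R) < m%:R by rewrite ltr0n.
have /andP[Al Au] := box_count_bounds k C N m0.
have -> : density d = (rhoN k C m)%:R / m%:R ^+ 2.
  by rewrite /density mul2n -addnn expnD natrM expr2.
set q := (N %/ m)%N in Al Au; set rho := rhoN k C m in Al Au *.
set A := box_count k C N m in Al Au *.
have {}Al : q%:R ^+ 2 * rho%:R <= A%:R :> R by rewrite -natrX -natrM ler_nat.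
have {}Au : A%:R <= (q%:R + 1) ^+ 2 * rho%:R :> R.
  by rewrite natr1 -natrX -natrM ler_nat.
have qN : q%:R * m%:R <= N%:R :> R by rewrite -natrM ler_nat leq_trunc_div.
have Nq : N%:R <= q.+1%:R * m%:R :> R by rewrite -natrM ler_nat ltnW// ltn_ceil.
have rhom : rho%:R <= 2 * c * m%:R by rewrite /c -!natrM ler_nat rho_pow_le.
have rho0 : (0 : R) <= rho%:R by exact: ler0n.
have q0 : (0 : R) <= q%:R by exact: ler0n.
set n : R := N%:R; pose s := n / m%:R.
have -> : n ^+ 2 * (rho%:R / m%:R ^+ 2) = s ^+ 2 * rho%:R.
  by rewrite /s; field; exact: lt0r_neq0.
have qs : q%:R <= s by rewrite ler_pdivlMr.
have sq : s <= q%:R + 1 by rewrite natr1 ler_pdivrMr.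
have sm : s * m%:R = n by rewrite /s divfK// lt0r_neq0.
move: (A%:R : R) Al Au => a Al Au.
have l1 : q%:R ^+ 2 * rho%:R <= s ^+ 2 * rho%:R.
  by rewrite ler_wpM2r// ler_sqr ?nnegrE// (le_trans q0).
have l2 : s ^+ 2 * rho%:R <= (q%:R + 1) ^+ 2 * rho%:R.
  by rewrite ler_wpM2r// ler_sqr ?nnegrE ?addr_ge0// (le_trans q0).
apply: (@le_trans _ _ ((q%:R + 1) ^+ 2 * rho%:R - q%:R ^+ 2 * rho%:R)).
  by rewrite ler_norml; lra.
have -> : (q%:R + 1) ^+ 2 * rho%:R - q%:R ^+ 2 * rho%:R = (2 * q%:R + 1) * rho%:R :> R by ring.
apply: le_trans (_ : (2 * q%:R + 1) * (2 * c * m%:R) <= _).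
  by rewrite ler_wpM2l// addr_ge0// mulr_ge0.
have -> : (2 * q%:R + 1) * (2 * c * m%:R) = 2 * c * (2 * (q%:R * m%:R) + m%:R) :> R by ring.
by rewrite ler_wpM2l ?mulr_ge0// lerD2r ler_wpM2l.
Qed.

Section FixedT.
Variable t : nat.
Hypothesis t_gt0 : (0 < t)%N.

Lemma density_setprod (S : {set 'I_t.+1}) : S \subset primeset t ->
  density (setprod S) = \prod_(i in S) density i.
Proof.
move=> SP; have [uS pS] := primes_enum SP.
rewrite /density setprodE rho_prod_primes// !big_map !big_enum /=.
rewrite (big_morph (fun n => n ^ (2 * k))%N (fun a b => expnMn a b _) (exp1n _)).
by rewrite !natr_prod -prodf_div.
Qed.

Lemma euler_factors_expand : euler_factors t.+1 =
  \sum_(S : {set 'I_t.+1} | S \subset primeset t) (-1) ^+ #|S| * density (setprod S).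
Proof.
rewrite /euler_factors big_mkcond.
rewrite (eq_bigr (fun i : 'I_t.+1 => (if prime i then - density i else 0) + 1)); last first.
  by move=> i _; case: ifP => _; rewrite ?add0r// addrC.
rewrite bigA_distr [RHS]big_mkcond; apply: eq_bigr => S _.
have [SP|/subsetPn[i iS]] := boolP (S \subset primeset t); last first.
  by rewrite inE => /negbTE ip; rewrite (bigD1 i)//= iS ip mul0r.
rewrite density_setprod// -prodr_const -big_split /= [RHS]big_mkcond.
apply: eq_bigr => i _; case: ifP => // iS; have := subsetP SP i iS.
by rewrite inE => ->; rewrite mulN1r.
Qed.

(** Besides the truncation error, [E1] is the cost of replacing box counts by densities for d <=
    t^2, and [E2] is the part d > t^2 of the expanded Euler product, which the truncated sum
    lacks. *)
Lemma sieve_count_main N :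
  `|(sieve_count k C N t)%:R - N%:R ^+ 2 * euler_factors t.+1|
  <= 3 * c * N%:R ^+ 2 / t%:R
     + t%:R ^+ 2 * (N%:R + 2 * c * (2 * N%:R + (t ^ (2 * k))%N%:R)).
Proof.
pose P := [pred d | (d <= t ^ 2)%N].
pose A (S : {set 'I_t.+1}) := (box_count k C N (setprod S ^ k))%:R : R.
set E1 := \sum_(S : {set 'I_t.+1} | (S \subset primeset t) && P (setprod S))
  (-1) ^+ #|S| * (A S - N%:R ^+ 2 * density (setprod S)).
set E2 := \sum_(S : {set 'I_t.+1} | (S \subset primeset t) && ~~ P (setprod S))
  (-1) ^+ #|S| * density (setprod S).
have E1le : `|E1| <= t%:R ^+ 2 * (2 * c * (2 * N%:R + (t ^ (2 * k))%N%:R)).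
  apply: (@le_trans _ _ (\sum_(S : {set 'I_t.+1} | (S \subset primeset t) && P (setprod S))
      2 * c * (2 * N%:R + (t ^ (2 * k))%N%:R))).
    rewrite (le_trans (ler_norm_sum _ _ _))//; apply: ler_sum => S /andP[SP dS].
    rewrite normrM normrX normrN1 expr1n mul1r.
    rewrite (le_trans (box_count_approx _ (setprod_gt0 SP)))//.
    apply: ler_wpM2l; first by rewrite mulr_ge0.
    by rewrite lerD2l ler_nat expnM leq_expn.
  apply: le_trans (@sum_setprod_le R t P (fun=> 2 * c *
    (2 * N%:R + (t ^ (2 * k))%N%:R)) 1 (t ^ 2).+1 _ _) _.
  - by move=> d; rewrite !mulr_ge0// addr_ge0 ?mulr_ge0 ?ler0n.
  - by move=> S SP; rewrite setprod_gt0.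
  - by rewrite sumr_const_nat subSS subn0 -natrX [leRHS]mulr_natl.
have E2le : `|E2| <= 2 * c / t%:R.
  apply: (@le_trans _ _ (\sum_(S : {set 'I_t.+1} | (S \subset primeset t) && ~~ P (setprod S))
      density (setprod S))).
    rewrite (le_trans (ler_norm_sum _ _ _))//; apply: ler_sum => S _.
    by rewrite normrM normrX normrN1 expr1n mul1r ger0_norm ?density_ge0.
  (* Any upper limit of summation would serve: the tail bound is uniform in it. *)
  pose X := (\max_(S : {set 'I_t.+1}) setprod S)%N.
  apply: le_trans (@sum_setprod_le R t (predC P) density (t ^ 2).+1 X.+1 _ _) _.
  - exact: density_ge0.
  - by move=> S SP; rewrite /= -ltnNge => ->; rewrite ltnS leq_bigmax.
  apply: le_trans (_ : \sum_((t ^ 2).+1 <= d < X.+1) 2 * c * ((d ^ k)%N%:R)^-1 <= _).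
    rewrite big_nat [leRHS]big_nat; apply: ler_sum => d /andP[td _].
    by apply: density_le; exact: leq_trans td.
  rewrite -mulr_sumr ler_wpM2l ?mulr_ge0//.
  apply: le_trans (sum_inv_pow_le _ _ _ _) _ => //; first by rewrite expn_gt0 t_gt0.
  by rewrite lef_pV2 ?posrE ?ltr0n ?expn_gt0 ?t_gt0// ler_nat -mulnn leq_pmull.
have := sieve_count_approx R N k_gt1 C_neq0 t_gt0.
set M := \sum_(S | _) _; set s := (sieve_count _ _ _ _)%:R => sM.
have -> : s - N%:R ^+ 2 * euler_factors t.+1 = (s - M) + E1 - N%:R ^+ 2 * E2.
  rewrite euler_factors_expand (bigID (fun S => P (setprod S))) /= -/E2.
  have -> : E1 = M - N%:R ^+ 2 * \sum_(S : {set 'I_t.+1} |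
      (S \subset primeset t) && P (setprod S)) (-1) ^+ #|S| * density (setprod S).
    by rewrite mulr_sumr -sumrB; apply: eq_bigr => S _; rewrite mulrBr [X in _ - X]mulrCA.
  by rewrite /P /=; ring.
have N2 : (0 : R) <= N%:R ^+ 2 by rewrite exprn_ge0.
have t0 : (0 : R) < t%:R by rewrite ltr0n.
apply: le_trans (ler_normB _ _) _; apply: le_trans (lerD (ler_normD _ _) (lexx _)) _.
rewrite normrM (ger0_norm N2).
have E2le' := ler_wpM2l N2 E2le.
apply: le_trans (lerD (lerD sM E1le) E2le') _.
rewrite natrX -/c le_eqVlt; apply/orP; left; apply/eqP; ring.
Qed.

End FixedT.

Lemma euler_factors_bounds n : 0 <= euler_factors n <= 1.
Proof.
apply/andP; split.
  by apply: prodr_ge0 => i /prime_gt0 i0; rewrite subr_ge0 density_le1.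
apply: prodr_ile1 => i /prime_gt0 i0.
by rewrite subr_ge0 density_le1//= gerBl density_ge0.
Qed.

Lemma euler_factorsS n :
  euler_factors n.+1 = euler_factors n * (if prime n then 1 - density n else 1).
Proof. by rewrite /euler_factors big_mkcond big_ord_recr /= -big_mkcond. Qed.

Lemma euler_factors_nonincreasing m n : (m <= n)%N ->
  euler_factors n <= euler_factors m.
Proof.
elim: n => [|n IH]; first by rewrite leqn0 => /eqP ->.
rewrite leq_eqVlt => /orP[/eqP ->//|/IH]; apply: le_trans.
rewrite euler_factorsS ler_piMr ?(andP (euler_factors_bounds n)).1//.
by case: ifP => // _; rewrite gerBl density_ge0.
Qed.

(** The partial products lie in [0, 1], so a new factor 1 - [density p] lowers the product by at
    most [density p] <= 2 c / p^k. *)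
Lemma euler_factors_tail t n : (0 < t)%N -> (t < n)%N ->
  euler_factors t.+1 - euler_factors n <= 2 * c / t%:R.
Proof.
move=> t0 tn; apply: le_trans (_ : 2 * c * \sum_(t.+1 <= d < n) ((d ^ k)%N%:R)^-1 <= _); last first.
  by rewrite ler_wpM2l ?mulr_ge0// sum_inv_pow_le.
elim: n tn => // n IH; rewrite ltnS leq_eqVlt => /orP[/eqP <-|tn].
  by rewrite subrr big_geq// mulr0.
rewrite big_nat_recr//= mulrDr; apply: le_trans (lerD (IH tn) (lexx _)).
have n0 : (0 < n)%N by exact: leq_trans tn.
have /andP[E0 E1] := euler_factors_bounds n.
have := density_le n0; have := density_ge0 n; rewrite (euler_factorsS n); case: ifP => _.
  move: (euler_factors n) E0 E1 => e e0 e1 g0 g1.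
  have : e * density n <= density n by rewrite ler_piMl.
  lra.
by move=> g0 g1; rewrite mulr1 lerDl (le_trans g0).
Qed.

End MainTerm.

Local Close Scope ring_scope.

(** * Choice of the parameters *)

Section Combination.
Variables (k : nat) (C : int).
Hypotheses (k_gt1 : 1 < k) (C_neq0 : C != 0%R).

Definition kfree_box (N : nat) : nat :=
  \sum_(1 <= x < N.+1) \sum_(1 <= y < N.+1)
    `[< ~ exists2 p, prime p & dvf k C (p ^ k) x y >].

Lemma kfree_box_le_sieve N t : kfree_box N <= sieve_count k C N t.
Proof.
apply: leq_sum => x _; apply: leq_sum => y _.
case: asboolP => // kf; rewrite lt0b; apply/eqP/setP => i; rewrite !inE.
by apply/negbTE/negP => /andP[ip di]; apply: kf; exists (val i).
Qed.

(** A pair that survives the sieve without being k-free has f = 0 or p^k dividing f for some p > t,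
    and the three ranges of p are separated here. Up to [B] all integers d may be counted; between
    [B] and [B'] primality is kept for the determinant argument. *)
Lemma sieve_le_kfree_box N t B B' : t <= B -> B <= B' ->
  sieve_count k C N t <= kfree_box N + N
    + \sum_(t.+1 <= d < B.+1) box_count k C N (d ^ k)
    + \sum_(B.+1 <= p < B'.+1 | prime p) box_count k C N (p ^ k)
    + \sum_(1 <= x < N.+1) \sum_(1 <= y < N.+1)
        `[< fval k C x y != 0%R /\ exists2 p, B' < p & dvf k C (p ^ k) x y >].
Proof.
move=> tB BB'; pose S1 x y := \sum_(t.+1 <= d < B.+1) dvf k C (d ^ k) x y.
pose S2 x y := \sum_(B.+1 <= p < B'.+1 | prime p) dvf k C (p ^ k) x y.
have -> : \sum_(t.+1 <= d < B.+1) box_count k C N (d ^ k) =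
    \sum_(1 <= x < N.+1) \sum_(1 <= y < N.+1) S1 x y.
  by rewrite exchange_big; apply: eq_bigr => x _; rewrite exchange_big.
have -> : \sum_(B.+1 <= p < B'.+1 | prime p) box_count k C N (p ^ k) =
    \sum_(1 <= x < N.+1) \sum_(1 <= y < N.+1) S2 x y.
  by rewrite exchange_big; apply: eq_bigr => x _; rewrite exchange_big.
have := sum_fval_eq0 N k_gt1 C_neq0; set Z := \sum_(_ <= _ < _) _ => ZN.
set A := \sum_(_ <= _ < _) \sum_(_ <= _ < _) S1 _ _.
set A' := \sum_(_ <= _ < _) \sum_(_ <= _ < _) S2 _ _.
set A'' := (X in _ <= _ + X).
suff : sieve_count k C N t <= kfree_box N + Z + A + A' + A''.
  by move=> /leq_trans; apply; rewrite !leq_add2r leq_add2l.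
rewrite /kfree_box /Z /A /A' /A'' -!big_split; apply: leq_sum => x _ /=.
rewrite -!big_split; apply: leq_sum => y _ /=.
have [P0|_] := eqVneq; last by [].
case: asboolP => [_|/contrapT[p p_pr dp]]; first by rewrite -!addnA.
have [f0|f0] := eqVneq (fval k C x y) 0%R.
  by rewrite add0n -!addnA.
have [pt|pt] := leqP p t.
  have pt' : p < t.+1 by [].
  have : Ordinal pt' \in powdivs k C t x y by rewrite !inE p_pr.
  by rewrite P0 inE.
have [pB|pB] := leqP p B.
  rewrite -!addnA !add0n (leq_trans _ (leq_addr _ _))// /S1.
  by rewrite (bigD1_seq p) ?iota_uniq ?mem_index_iota ?pt//= dp.
have [pB'|pB'] := leqP p B'.
  rewrite (leq_trans _ (leq_addr _ _))// (leq_trans _ (leq_addl _ _))// /S2.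
  rewrite big_mkcond (bigD1_seq p) ?iota_uniq ?mem_index_iota ?pB//=.
  by rewrite p_pr dp.
rewrite (leq_trans _ (leq_addl _ _))// lt0b; apply/asboolP.
by split => //; exists p.
Qed.

Let c := k.+2 * (k + 6).
(* With w this exponent and L = t^4, N ~ t^w, p > t^(w-1), the inequality
   L^c N^(k+3) < p^(3k) of the determinant argument amounts to
   4 c + w (k + 3) < 3 k (w - 1), which holds since (2 k - 3) w >= w. *)
Definition window_exponent := 3 * k + 4 * c + 1.
Let w := window_exponent.

Let w_ge : [/\ 3 * k < w, 4 < w.-1 & 2 <= w.-2].
Proof.
have : 2 * 6 <= c by rewrite leq_mul//; lia.
by rewrite /w /window_exponent; move: (c) => c' h; split; lia.
Qed.

(** One factor t absorbs the constants, which leaves 1 + 4 c + w (k + 3) <= 3 k (w - 1). By the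
    choice of w this reads w <= (2 k - 3) w, an equality for k = 2; strictness comes from t^(w-1) <
    p. *)
Lemma critical_numerics N t p : (k + 6)`! * (2 ^ w) ^ k.+3 <= t ->
  N <= 2 ^ w * t ^ w -> t ^ w.-1 < p ->
  (k + 6)`! * ((t ^ 4) ^ c * N ^ k.+3) < p ^ (3 * k).
Proof.
move=> t_large NU pB.
have t0 : 0 < t by apply: leq_trans t_large; rewrite muln_gt0 fact_gt0 !expn_gt0.
apply: (@leq_ltn_trans ((t ^ w.-1) ^ (3 * k))); last by rewrite ltn_exp2r//; lia.
apply: leq_trans (_ : (k + 6)`! * ((t ^ 4) ^ c * (2 ^ w * t ^ w) ^ k.+3) <= _).
  by rewrite leq_mul2l leq_mul2l leq_expn ?orbT.
rewrite expnMn; have -> : (k + 6)`! * ((t ^ 4) ^ c * ((2 ^ w) ^ k.+3 * (t ^ w) ^ k.+3)) =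
  ((k + 6)`! * (2 ^ w) ^ k.+3) * ((t ^ 4) ^ c * (t ^ w) ^ k.+3) by ring.
apply: leq_trans (leq_mul t_large (leqnn _)) _.
rewrite -!expnM -expnD -expnS leq_pexp2l//.
have wE : w = (3 * k + 4 * c).+1 by rewrite /w /window_exponent addn1.
have := w_ge; move: w wE => v vE _; rewrite vE /=; nia.
Qed.

Lemma divisors_of_critical : exists K, forall N t n, 0 < t ->
  N <= 2 ^ w * t ^ w -> 0 < n ->
  n <= (k + 4)`! * ((k + 6)`! * ((t ^ 4) ^ k.+2 * N) ^ (k + 6)) ^ (k + 4) ->
  size (divisors n) <= K * t.
Proof.
(* [r] is the exponent of t in the bound for n, so that tau(n)^r <= K n <= K K' t^r and the r-th
   root is O(t). *)
pose r := (4 * k.+2 + w) * (k + 6) * (k + 4).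
have r0 : 0 < r by rewrite /r !muln_gt0 !addnS.
have [K K0 divK] := divisor_bound r0.
pose K' := (k + 4)`! * ((k + 6)`! * (2 ^ w) ^ (k + 6)) ^ (k + 4).
exists (K * K') => N t n t0 NU n0 nle.
rewrite -(@leq_exp2r _ _ r)// (leq_trans (divK n n0))//.
have KK : K * K' <= (K * K') ^ r.
  rewrite -[leqLHS]expn1 leq_pexp2l// muln_gt0 K0 /K' muln_gt0 fact_gt0 /=.
  by rewrite expn_gt0 muln_gt0 fact_gt0 !expn_gt0.
rewrite expnMn (leq_trans _ (leq_mul KK (leqnn _)))// -mulnA leq_mul2l.
apply/orP; right; apply: leq_trans nle _.
have -> : t ^ r = (((t ^ 4) ^ k.+2 * t ^ w) ^ (k + 6)) ^ (k + 4).
  by rewrite -!expnM -expnD -!expnM; congr (_ ^ _); rewrite /r; ring.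
rewrite /K' -mulnA -expnMn -mulnA -expnMn leq_mul2l; apply/orP; right.
apply: leq_expn; rewrite leq_mul2l; apply/orP; right; apply: leq_expn.
by rewrite mulnCA leq_mul2l NU orbT.
Qed.

(** At most t^(w+1) primes, O(t^(w-4)) windows of length t^4 for each, and O(t) solutions per
    window: O(t^(2w-2)) in all. The window length outweighs both the width of the critical range and
    the divisor bound. *)
Lemma critical_sum_le : exists K t0, forall N t, t0 <= t -> 0 < N ->
  N <= 2 ^ w * t ^ w ->
  \sum_((t ^ w.-1).+1 <= p < (t ^ w.+1).+1 | prime p) box_count k C N (p ^ k)
    <= K * t ^ (2 * w).-1.
Proof.
have [K divK] := divisors_of_critical.
pose K1 := K * (2 * k.+2) + k.+3 + k.+2 * k.+2.
(* The three terms of the threshold give, in order, the determinant inequality, N < p^k, and p not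
   dividing C. *)
exists (2 ^ w.+1 * K1), ((k + 6)`! * (2 ^ w) ^ k.+3 + 2 ^ w + `|C|).
move=> N t t_large N0 NU.
have t1 : (k + 6)`! * (2 ^ w) ^ k.+3 <= t by rewrite (leq_trans _ t_large)// -addnA leq_addr.
have t2 : 2 ^ w <= t by rewrite (leq_trans _ t_large)// addnAC leq_addl.
have t3 : `|C| <= t by rewrite (leq_trans _ t_large)// leq_addl.
have t0 : 0 < t by rewrite (leq_trans _ t2)// expn_gt0.
have [w3k w4 w2] := w_ge.
have L0 : 0 < t ^ 4 by rewrite expn_gt0 t0.
have crit p : t ^ w.-1 < p -> prime p ->
    box_count k C N (p ^ k) <= (N %/ t ^ 4).+1 * cluster_bound k (K * t).
  move=> Bp p_pr; apply: sum_critical_prime_le => //.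
  - exact: ltnW.
  - by move=> n n0 nle; apply: (divK N t).
  - rewrite dvdzE /= gtnNdvd ?absz_gt0// (leq_ltn_trans t3)// (leq_ltn_trans _ Bp)//.
    by rewrite -[leqLHS]expn1 leq_pexp2l//; lia.
  - by rewrite ltnW// (leq_ltn_trans _ Bp)// leq_pexp2l// ltnW.
  - apply: leq_ltn_trans NU _; apply: (@leq_ltn_trans ((t ^ w.-1) ^ k)).
      apply: leq_trans (leq_mul t2 (leqnn _)) _.
      rewrite -expnS -expnM leq_pexp2l//.
      by apply: leq_trans (leq_mul (leqnn w.-1) k_gt1); clear -w4; lia.
    by rewrite ltn_exp2r// ltnW.
  - exact: critical_numerics.
have Phi : cluster_bound k (K * t) <= K1 * t.
  rewrite /cluster_bound /K1 -/K1 !mulnDl -[K * t * _]mulnAC.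
  by rewrite leq_add ?leq_add ?leq_pmulr.
apply: leq_trans (_ : \sum_((t ^ w.-1).+1 <= p < (t ^ w.+1).+1) (N %/ t ^ 4).+1 * (K1 * t) <= _).
  rewrite big_nat_cond [leqRHS]big_nat big_mkcond [leqRHS]big_mkcond.
  apply: leq_sum => p _; case: ifP => [/andP[/andP[Bp pB'] p_pr]|_//].
  by rewrite Bp pB' (leq_trans (crit p Bp p_pr))// leq_mul2l Phi orbT.
rewrite sum_nat_const_nat subSS.
apply: leq_trans (_ : t ^ w.+1 * (2 ^ w.+1 * t ^ (w - 4) * (K1 * t)) <= _).
  rewrite leq_mul ?leq_subr// leq_mul2r; apply/orP; right.
  have wE : t ^ w = t ^ (w - 4) * t ^ 4 by rewrite -expnD subnK//; lia.
  have : N %/ t ^ 4 <= 2 ^ w * t ^ (w - 4).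
    rewrite -ltnS ltn_divLR// mulSn (leq_trans (_ : _ < N.+1))//.
    by rewrite (leq_ltn_trans NU)// wE mulnA -[ltnLHS]add0n ltn_add2r.
  have : 0 < 2 ^ w * t ^ (w - 4) by rewrite muln_gt0 !expn_gt0 t0.
  rewrite (expnS 2 w) -mulnA; move: (2 ^ w * _) (N %/ _) => a b; lia.
have -> : t ^ w.+1 * (2 ^ w.+1 * t ^ (w - 4) * (K1 * t)) =
  2 ^ w.+1 * K1 * (t ^ w.+1 * t ^ (w - 4) * t) by ring.
rewrite leq_mul2l -expnD -expnSr leq_pexp2l ?orbT//; lia.
Qed.

(** For p > t^(w+1), f = O(t^(w(k+1))) leaves |m| = O(t^(w-k)), hence O(t^(2w-k)) pairs. The
    threshold on t ensures |C| N <= t^(w+1). *)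
Lemma large_sum_le : exists K t0, forall N t, t0 <= t -> N <= 2 ^ w * t ^ w ->
  \sum_(1 <= x < N.+1) \sum_(1 <= y < N.+1)
     `[< fval k C x y != 0%R /\ exists2 p, t ^ w.+1 < p & dvf k C (p ^ k) x y >]
  <= K * t ^ (2 * w).-1.
Proof.
have [w3k w4 w2] := w_ge.
exists (2 ^ w * ((2 ^ w) ^ k.+1 * 2 * 2)), (`|C| * 2 ^ w) => N t t_large NU.
have C0 : 0 < `|C| by rewrite absz_gt0.
have t2 : 2 ^ w <= t by rewrite (leq_trans _ t_large)// leq_pmull.
have tC : `|C| <= t by rewrite (leq_trans _ t_large)// leq_pmulr// expn_gt0.
have t0 : 0 < t by rewrite (leq_trans _ t2)// expn_gt0.
apply: leq_trans (@sum_large_primes_le k C N k_gt1 C_neq0 _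
  ((2 ^ w) ^ k.+1 * 2 * t ^ (w - k)) _ _) _.
- rewrite expnS; apply: leq_trans (leq_mul (leqnn _) NU) _.
  by rewrite mulnA leq_mul2r t_large orbT.
- rewrite -(expnM t) -mulnA -expnD.
  have -> : w - k + w.+1 * k = w * k.+1 by nia.
  apply: leq_trans (_ : (2 ^ w * t ^ w) ^ k.+1 * 2 <= _); last first.
    by rewrite expnMn -(expnM t) mulnAC.
  rewrite muln2 -addnn leq_add ?leq_expn//.
  apply: leq_trans tC _; apply: leq_trans (_ : t ^ w <= _).
    by rewrite -[leqLHS]expn1 leq_pexp2l//; lia.
  rewrite expnMn -[leqLHS]mul1n leq_mul ?expn_gt0//.
  by rewrite -[leqLHS]expn1 leq_pexp2l// expn_gt0 t0.
apply: leq_trans (leq_mul NU (leqnn _)) _.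
have -> : 2 ^ w * t ^ w * ((2 ^ w) ^ k.+1 * 2 * t ^ (w - k) * 2) =
  2 ^ w * ((2 ^ w) ^ k.+1 * 2 * 2) * (t ^ w * t ^ (w - k)) by ring.
rewrite leq_mul2l -expnD leq_pexp2l ?orbT//; lia.
Qed.

End Combination.

From mathcomp Require Import all_classical all_reals all_analysis.
Import Order.TTheory GRing.Theory Num.Theory.
Import numFieldNormedType.Exports.
Local Open Scope classical_set_scope.
Local Open Scope ring_scope.

(** * The asymptotic formula *)

Lemma rhoE k C m : rho (fpoly k C) m = rhoN k C m.
Proof.
rewrite /rho -sum1_card /rhoN big_mkord.
under [RHS]eq_bigr do rewrite big_mkord.
rewrite pair_big big_mkcond; apply: eq_bigr => -[u v] _ /=.
by rewrite inE /= /dvf /fval /fpoly; case: (_ \in _).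
Qed.

Lemma euler_partialE (R : realType) k C n :
  euler_partial R k (fpoly k C) n = euler_factors R k C n.
Proof. by apply: eq_bigr => p _; rewrite /density rhoE. Qed.

Lemma kfree_countE (R : realType) k C (H : R) : 1 <= H ->
  kfree_count k (fpoly k C) H = kfree_box k C (Num.truncn H).
Proof.
move=> H1; set N := Num.truncn H.
pose I := index_iota 1 N.+1.
pose s := [seq z <- [seq (Posz x, Posz y) | x <- I, y <- I] |
            `[< kfree k (fpoly k C z.1 z.2) >]].
have us : uniq s.
  rewrite filter_uniq// allpairs_uniq ?iota_uniq//.
  by move=> [x y] [x' y'] _ _ /= [-> ->].
have NH (n : nat) : (n \in I) = (1 <= (n%:Z%:~R : R) <= H).
  rewrite mem_index_iota ltnS /N truncn_ge_nat ?(le_trans ler01)//.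
  by rewrite -[(n%:Z)%:~R]/(n%:R) ler1n.
have memI (z : int) : 1 <= (z%:~R : R) <= H -> exists2 n, n \in I & z = Posz n.
  case: z => n zH; first by exists n; rewrite // NH.
  by move: zH => /andP[]; rewrite -[1 : R]/(1%:~R) ler_int.
have -> : kfree_count k (fpoly k C) H = size s.
  rewrite /kfree_count; have -> : fset_set (kfree_pairs k (fpoly k C) H) = [fset z in s]%fset.
    apply/fsetP => -[x y]; rewrite in_fset_set; last exact: finite_kfree_pairs.
    rewrite !inE /=; apply/idP/idP.
      rewrite inE /= => -[/memI[m mI xE] /memI[n nI yE] kf].
      have {}xE : x = Posz m := xE; have {}yE : y = Posz n := yE; subst x y.
      rewrite mem_filter /=; apply/andP; split; first exact/asboolP.
      exact: (allpairs_f (fun x y => (Posz x, Posz y))).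
    rewrite mem_filter /= => /andP[/asboolP kf /allpairsP[[m n] /= [mI nI [xE yE]]]].
    by rewrite inE /=; split => //; rewrite ?xE ?yE -NH.
  by rewrite card_fseq undup_id.
rewrite /s size_filter -sum1_count big_mkcond big_allpairs_dep /=.
apply: eq_bigr => x _; apply: eq_bigr => y _.
by rewrite /kfree /fpoly /dvf /fval /=; case: `[< _ >].
Qed.

Section FinalEstimate.
Variables (R : realType) (k : nat) (C : int).
Hypotheses (k_gt1 : (1 < k)%N) (C_neq0 : C != 0).

Let w := window_exponent k.
Let c : R := `|C|%N%:R.

(** Every error is O(t^(2w-1)): N^2 / t from the truncation, the medium moduli and the Euler tail; N
    t^(w-1) from the rounding in the medium range; smaller powers of t from the box counts. The
    constant [cf] may be any number with the stated distance to the partial product; the limit is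
    substituted later. *)
Lemma kfree_box_approx : exists (K : R) (t0 : nat), 0 <= K /\
  forall N t (cf : R), (t0 <= t)%N -> (0 < t)%N ->
    (t ^ w <= N)%N -> (N <= 2 ^ w * t ^ w)%N ->
    0 <= euler_factors R k C t.+1 - cf <= 2 * c / t%:R ->
    `|(kfree_box k C N)%:R - cf * N%:R ^+ 2| <= K * t%:R ^+ (2 * w).-1.
Proof.
have wk : (3 * k < window_exponent k)%N by rewrite /window_exponent; lia.
have := large_sum_le k_gt1 C_neq0; have := critical_sum_le k_gt1 C_neq0.
rewrite /w; move: (window_exponent k) wk => v vk [K1 [t1 crit]] [K2 [t2 large]].
pose W : R := 2 ^+ v.
have W0 : 0 <= W by rewrite exprn_ge0.
have c0 : 0 <= c by exact: ler0n.
(* The coefficient 6 is 3 from the sieve, 2 from the Euler tail and 1 from the medium moduli. W (1 +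
   4 c) + 2 c comes from the box counts, and 2 W from the zeros of f and the rounding in the medium
   range. *)
exists (6 * c * W ^+ 2 + W * (1 + 4 * c) + 2 * c + 2 * W + K1%:R + K2%:R), (t1 + t2)%N.
split; first by rewrite !addr_ge0 ?mulr_ge0 ?addr_ge0 ?exprn_ge0 ?mulr_ge0 ?ler0n.
move=> N t cf tt t0 NL NU /andP[cf0 cf1].
have [tt1 tt2] : (t1 <= t)%N /\ (t2 <= t)%N by (clear -tt; lia).
have N0 : (0 < N)%N by apply: leq_trans NL; rewrite expn_gt0 t0.
have tB : (t <= t ^ v.-1)%N by rewrite -[leqLHS]expn1 leq_pexp2l//; clear -vk k_gt1; lia.
have BB : (t ^ v.-1 <= t ^ v.+1)%N by rewrite leq_pexp2l//; clear -vk k_gt1; lia.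
have kf_s := kfree_box_le_sieve k C N t.
have s_kf := sieve_le_kfree_box k_gt1 C_neq0 N tB BB.
have mainE := sieve_count_main R k_gt1 C_neq0 t0 N.
have smallE := sum_box_counts_le R N k_gt1 C_neq0 t0 (t ^ v.-1).
rewrite -natr_sum in smallE.
have critE := crit N t tt1 N0 NU; have largeE := large N t tt2 NU.
have {s_kf critE largeE} s_kf := leq_trans s_kf (leq_add (leq_add (leqnn _) critE) largeE).
set A1 := (\sum_(_ <= d < _) _)%N in smallE s_kf.
set s := sieve_count k C N t in kf_s s_kf mainE.
set kf := kfree_box k C N in kf_s s_kf *.
rewrite -/c in smallE mainE.
have {}kf_s : kf%:R <= s%:R :> R by rewrite ler_nat.
have {}s_kf : s%:R <= kf%:R + N%:R + A1%:R + K1%:R * t%:R ^+ (2 * v).-1 +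
    K2%:R * t%:R ^+ (2 * v).-1 :> R.
  by rewrite -!natrX -!natrM -!natrD ler_nat.
set T : R := t%:R ^+ (2 * v).-1 in s_kf *.
set tau : R := t%:R in T s_kf mainE smallE cf1 *; set n : R := N%:R in s_kf mainE smallE *.
have tau1 : 1 <= tau by rewrite ler1n.
have tau0 : 0 < tau by exact: lt_le_trans tau1.
have n0 : 0 <= n by exact: ler0n.
have nU : n <= W * tau ^+ v by rewrite /n /W /tau -!natrX -natrM ler_nat.
have T0 : 0 <= T by rewrite exprn_ge0// ltW.
have pow_le_T m : (m <= (2 * v).-1)%N -> tau ^+ m <= T by move=> mT; exact: ler_weXn2l.
have q_le : n ^+ 2 / tau <= W ^+ 2 * T.
  have Ttau : T * tau = tau ^+ (2 * v).
    have -> : (2 * v = (2 * v).-1.+1)%N by (clear -vk k_gt1; lia).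
    by rewrite [RHS]exprSr.
  rewrite ler_pdivrMr// -mulrA Ttau.
  by rewrite mulnC exprM -exprMn ler_sqr ?nnegrE ?mulr_ge0 ?exprn_ge0// ltW.
have nB_le : n * (t ^ v.-1)%N%:R <= W * T.
  rewrite natrX -/tau; apply: le_trans (ler_wpM2r _ nU) _; first by rewrite exprn_ge0// ltW.
  rewrite -mulrA ler_wpM2l// -exprD; apply: pow_le_T; clear -vk k_gt1; lia.
have n_le : n <= n * (t ^ v.-1)%N%:R by rewrite ler_peMr// ler1n expn_gt0 t0.
have tn_le : tau ^+ 2 * n <= W * T.
  apply: le_trans (ler_wpM2l _ nU) _; first by rewrite exprn_ge0// ltW.
  rewrite mulrCA ler_wpM2l// -exprD; apply: pow_le_T; clear -vk k_gt1; lia.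
have tD_le : tau ^+ 2 * (t ^ (2 * k))%N%:R <= T.
  rewrite natrX -exprD; apply: pow_le_T; clear -vk k_gt1; lia.
have cq_le := ler_wpM2l c0 q_le; have ctn_le := ler_wpM2l c0 tn_le.
have ctD_le := ler_wpM2l c0 tD_le.
set E := euler_factors R k C t.+1 in cf0 cf1 mainE.
have Ecf : n ^+ 2 * (E - cf) <= 2 * (c * (n ^+ 2 / tau)).
  apply: le_trans (ler_wpM2l _ cf1) _; first by rewrite exprn_ge0.
  rewrite le_eqVlt; apply/orP; left; apply/eqP; ring.
have Ecf0 : 0 <= n ^+ 2 * (E - cf) by rewrite mulr_ge0// exprn_ge0.
have main_le : `|s%:R - n ^+ 2 * E| <=
    3 * (c * (W ^+ 2 * T)) + W * T + 4 * (c * (W * T)) + 2 * (c * T).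
  apply: le_trans mainE _.
  have -> : 3 * c * n ^+ 2 / tau = 3 * (c * (n ^+ 2 / tau)) by ring.
  have -> : tau ^+ 2 * (n + 2 * c * (2 * n + (t ^ (2 * k))%N%:R)) =
    tau ^+ 2 * n + 4 * (c * (tau ^+ 2 * n)) + 2 * (c * (tau ^+ 2 * (t ^ (2 * k))%N%:R)) by ring.
  by lra.
have small_le : A1%:R <= c * (W ^+ 2 * T) + W * T.
  apply: le_trans smallE _; have -> : n ^+ 2 * c / tau = c * (n ^+ 2 / tau) by ring.
  by lra.
have n_le' := le_trans n_le nB_le.
have -> : kf%:R - cf * n ^+ 2 = (kf%:R - s%:R) + (s%:R - n ^+ 2 * E) + n ^+ 2 * (E - cf) by ring.
have -> : (6 * c * W ^+ 2 + W * (1 + 4 * c) + 2 * c + 2 * W + K1%:R + K2%:R) * T =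
  6 * (c * (W ^+ 2 * T)) + W * T + 4 * (c * (W * T)) + 2 * (c * T) + 2 * (W * T) +
  K1%:R * T + K2%:R * T by ring.
move: main_le; rewrite !ler_norml => /andP[ml mu].
have K10 : 0 <= K1%:R * T by rewrite mulr_ge0.
have K20 : 0 <= K2%:R * T by rewrite mulr_ge0.
have WT0 : 0 <= W * T by rewrite mulr_ge0.
have cWT0 : 0 <= c * (W ^+ 2 * T) by rewrite !mulr_ge0// exprn_ge0.
clear -Ecf Ecf0 small_le n_le' ml mu K10 K20 WT0 cWT0 s_kf kf_s cq_le.
by apply/andP; split; lra.
Qed.

End FinalEstimate.

(** Take the largest t with t^w <= N; then N < (t + 1)^w <= (2 t)^w. *)
Lemma exists_root (w N : nat) : (0 < w)%N -> (0 < N)%N ->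
  exists t, [/\ (0 < t)%N, (t ^ w <= N)%N & (N <= 2 ^ w * t ^ w)%N].
Proof.
move=> w0 N0; pose P t := (t ^ w <= N)%N.
have P1 : exists t, P t by exists 1%N; rewrite /P exp1n.
have PN t : P t -> (t <= N)%N.
  move=> Pt; apply: leq_trans Pt; have [->//|t0] := posnP t.
  by rewrite -[leqLHS]expn1 leq_pexp2l.
case: (ex_maxnP P1 PN) => t Pt tmax; have t0 : (0 < t)%N by apply: tmax; rewrite /P exp1n.
exists t; split => //; rewrite -expnMn ltnW//.
apply: (@leq_trans (t.+1 ^ w)); last by rewrite leq_exp2r// mul2n -addnn -addn1 leq_add2l.
by rewrite ltnNge; apply/negP => /tmax; rewrite ltnn.
Qed.

Lemma euler_factors_cvg (R : realType) k C : (1 < k)%N -> C != 0 ->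
  cvgn (euler_factors R k C : R^nat).
Proof.
move=> k1 C0; apply: nonincreasing_is_cvgn.
  by move=> m n mn; exact: euler_factors_nonincreasing.
by exists 0 => _ [n _ <-]; case/andP: (euler_factors_bounds R k C n).
Qed.

(** The bound of [euler_factors_tail] is uniform in n and passes to the limit. *)
Lemma euler_factors_lim (R : realType) k C (cf := limn (euler_factors R k C : R^nat)) :
  (1 < k)%N -> C != 0 ->
  (0 <= cf <= 1) /\ forall t, (0 < t)%N ->
    0 <= euler_factors R k C t.+1 - cf <= 2 * `|C|%N%:R / t%:R.
Proof.
move=> k1 C0; have cvE := @euler_factors_cvg R k C k1 C0.
have cfE n : cf <= euler_factors R k C n.
  apply: nonincreasing_cvgn_ge => // i j ij.
  exact: euler_factors_nonincreasing.
split.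
  apply/andP; split.
    apply: limr_ge => //; near=> n.
    by case/andP: (euler_factors_bounds R k C n).
  apply: le_trans (cfE 0%N) _.
  by case/andP: (euler_factors_bounds R k C 0).
move=> t t0; apply/andP; split; first by rewrite subr_ge0.
rewrite lerBlDr -lerBlDl; apply: limr_ge => //; near=> n.
rewrite lerBlDl -lerBlDr; apply: euler_factors_tail => //.
by near: n; exact: nbhs_infty_gt.
Unshelve. all: by end_near.
Qed.

Theorem theorem1 (R : realType) (k : nat) (C : int)
    (hk : (2 <= k)%N) (hC : C != 0) :
  cvgn (euler_partial R k (fpoly k C)) /\
  exists2 delta : R, 0 < delta &
    exists K : R, forall H : R, 1 <= H ->
      `|(kfree_count k (fpoly k C) H)%:R
          - euler_product R k (fpoly k C) * H ^+ 2|
        <= K * H `^ (2 - delta).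
Proof.
have epE : euler_partial R k (fpoly k C) = euler_factors R k C.
  by apply/funext => n; rewrite euler_partialE.
rewrite /euler_product epE; split; first exact: euler_factors_cvg.
have [/andP[cf0 cf1] cft] := @euler_factors_lim R k C hk hC.
have [K [t0 [K0 approx]]] := @kfree_box_approx R k C hk hC.
have w1 : (1 <= window_exponent k)%N by rewrite /window_exponent; lia.
move: (window_exponent k) w1 approx (limn _) cf0 cf1 cft => w w1 approx cf cf0 cf1 cft.
have w0 : (0 : R) < w%:R by rewrite ltr0n.
(* The error t^(2w-1) is (t^w)^(2 - 1/w), and t^w <= N <= H. *)
exists (w%:R)^-1; first by rewrite invr_gt0.
pose N1 := (2 ^ w * t0 ^ w)%N.
(* [K] serves t >= t0, and [N1] squared the bounded range t < t0. The 2 pays for replacing N by H: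
   H^2 - N^2 <= H + N <= 2 H, with 0 <= cf <= 1 and exponent 2 - 1/w >= 1. *)
exists (K + N1%:R ^+ 2 + 2) => H H1; rewrite kfree_countE//.
set N := Num.truncn H.
have H0 : 0 <= H by exact: le_trans H1.
have N_gt0 : (0 < N)%N by rewrite /N truncn_gt0.
have NH : N%:R <= H by rewrite truncn_le.
have HN : H < N%:R + 1 by rewrite natr1; exact: truncnS_gt.
set e := 2 - (w%:R)^-1.
have e1 : 1 <= e.
  by rewrite /e lerBrDl -lerBrDr (le_trans (_ : _ <= 1))// ?invf_le1 ?ler1n//; lra.
have He : 1 <= H `^ e.
  by rewrite -[leLHS](powRr0 H) ler_powR// (le_trans ler01).
have HHe : H <= H `^ e by rewrite -{1}(powRr1 H0) ler_powR.
have square_le : cf * (H ^+ 2 - N%:R ^+ 2) <= 2 * H `^ e.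
  apply: le_trans (_ : 1 * (H ^+ 2 - N%:R ^+ 2) <= _).
    by rewrite ler_wpM2r// subr_ge0 ler_sqr ?nnegrE.
  rewrite mul1r subr_sqr; apply: le_trans (_ : 1 * (H + N%:R) <= _); last by lra.
  by rewrite ler_wpM2r ?addr_ge0 ?ler0n//; lra.
have square_ge : 0 <= cf * (H ^+ 2 - N%:R ^+ 2).
  by rewrite mulr_ge0// subr_ge0 ler_sqr ?nnegrE.
suff main : `|(kfree_box k C N)%:R - cf * N%:R ^+ 2| <= (K + N1%:R ^+ 2) * H `^ e.
  have -> : (kfree_box k C N)%:R - cf * H ^+ 2 =
    (kfree_box k C N)%:R - cf * N%:R ^+ 2 - cf * (H ^+ 2 - N%:R ^+ 2) by ring.
  apply: le_trans (ler_normB _ _) _; rewrite (ger0_norm square_ge) [leRHS]mulrDl.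
  exact: lerD.
have [t [t_gt0 tN Nt]] := exists_root w1 N_gt0.
have [t0t|tt0] := leqP t0 t.
  apply: le_trans (approx N t cf t0t t_gt0 tN Nt (cft t t_gt0)) _.
  have -> : t%:R ^+ (2 * w).-1 = (t%:R ^+ w : R) `^ e.
    rewrite -!powR_mulrn ?ler0n// -powRrM; congr (_ `^ _).
    rewrite /e mulrBr divff ?lt0r_neq0// -subn1 natrB ?natrM ?muln_gt0//.
    by rewrite mulrC.
  have tH : (t%:R ^+ w : R) `^ e <= H `^ e.
    apply: ge0_ler_powR; rewrite ?nnegrE ?exprn_ge0// ?(le_trans ler01)//.
    by rewrite (le_trans _ NH)// -natrX ler_nat.
  apply: le_trans (ler_wpM2l K0 tH) _.
  by rewrite ler_wpM2r ?powR_ge0// lerDl exprn_ge0.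
(* For t < t0, N is bounded, and both the count and its main term lie between 0 and N^2. *)
have NN1 : (N <= N1)%N.
  by rewrite (leq_trans Nt)// leq_mul2l leq_exp2r// ltnW ?orbT.
have kfN : (kfree_box k C N)%:R <= N%:R ^+ 2 :> R.
  rewrite -natrX ler_nat.
  apply: leq_trans (_ : (\sum_(1 <= x < N.+1) \sum_(1 <= y < N.+1) 1 <= _)%N).
    by apply: leq_sum => x _; apply: leq_sum => y _; exact: leq_b1.
  by rewrite !sum_nat_const_nat subn1 muln1 -mulnn.
have cfN : cf * N%:R ^+ 2 <= N%:R ^+ 2 by rewrite ler_piMl ?exprn_ge0.
have cfN0 : 0 <= cf * N%:R ^+ 2 by rewrite mulr_ge0 ?exprn_ge0.
have kf0 : (0 : R) <= (kfree_box k C N)%:R by exact: ler0n.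
apply: le_trans (_ : N%:R ^+ 2 <= _); first by rewrite ler_norml; lra.
apply: le_trans (_ : N1%:R ^+ 2 * 1 <= _).
  by rewrite mulr1 ler_sqr ?nnegrE// ler_nat.
by rewrite ler_pM ?exprn_ge0// lerDr.
Qed.
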